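(* $\mathcal{PMV}(4,2)=\Big\{v=(v_{ij})_{1\le i<j\le 4}\in\mathbb R_{\ge0}^{6}\ :\ v_{ij}v_{kl}\le v_{ik}v_{jl}+v_{il}v_{jk}\ \text{for all } \{i,j\}\sqcup\{k,l\}=\{1,2,3,4\}\Big\}.$ Equivalently, $\mathcal{PMV}(4,2)$ is the set of nonnegative $v\in\mathbb R^6$ satisfying $v_{12}v_{34}+v_{13}v_{24}-v_{14}v_{23}\ge0$, $v_{12}v_{34}-v_{13}v_{24}+v_{14}v_{23}\ge0$, $-v_{12}v_{34}+v_{13}v_{24}+v_{14}v_{23}\ge0$.
   Context: $\mathcal K_2$ denotes the set of nonempty compact convex subsets of $\mathbb R^2$. The mixed area of $K,L\in\mathcal K_2$ is $\mathrm V(K,L)=\tfrac12\big(\mathrm{Vol}_2(K+L)-\mathrm{Vol}_2(K)-\mathrm{Vol}_2(L)\big)$ (Minkowski sum, Lebesgue area). Coordinates of $\mathbb R^{\binom n2}$ are indexed by unordered pairs $\{i,j\}\subset[n]=\{1,\dots,n\}$, written $v_{ij}=v_{ji}$. The pure mixed area configuration space is $\mathcal{PMV}(n,2)=\{(\mathrm V(K_i,K_j))_{\{i,j\}\subset[n]}\in\mathbb R^{\binom n2} : K_1,\dots,K_n\in\mathcal K_2\}$. *)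

(* Defs.v *)
From HB Require Import structures.
From mathcomp Require Import all_boot all_order all_algebra.
From mathcomp Require Import all_classical all_reals all_analysis.
Set Implicit Arguments. Unset Strict Implicit. Unset Printing Implicit Defensive.
Import Order.TTheory GRing.Theory Num.Theory.
Local Open Scope classical_set_scope.
Local Open Scope ring_scope.
Import numFieldNormedType.Exports.

Section Defs.
Variable R : realType.

Definition convex2 (K : set (R * R)) : Prop :=
  forall x y, K x -> K y -> forall t : R, 0 <= t -> t <= 1 ->
    K (t * x.1 + (1 - t) * y.1, t * x.2 + (1 - t) * y.2).

Definition convex_body2 (K : set (R * R)) : Prop :=
  K !=set0 /\ @compact (R * R)%type K /\ convex2 K.

Definition minkowski_sum (K L : set (R * R)) : set (R * R) :=
  [set z | exists x y, K x /\ L y /\ z = (x.1 + y.1, x.2 + y.2)].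

Definition area (K : set (R * R)) : R :=
  fine (((@lebesgue_measure R) \x (@lebesgue_measure R)) K)%E.

Definition mixed_area (K L : set (R * R)) : R :=
  (area (minkowski_sum K L) - area K - area L) / 2.

End Defs.

(* Main.v *)
Require Import Defs.
From HB Require Import structures.
From mathcomp Require Import all_boot all_order all_algebra.
From mathcomp Require Import all_classical all_reals all_analysis.
From mathcomp Require Import measurable_realfun ring lra.
Import Order.TTheory GRing.Theory Num.Theory.
Import numFieldNormedType.Exports.
Local Open Scope classical_set_scope.
Local Open Scope ring_scope.
Set Implicit Arguments.
Unset Strict Implicit.

(* A convex body is obtained from its bounding box by cutting off, for every
   pair (u, v) of neighbours in the Stern-Brocot tree of integer directions, a
   triangle of area (h u + h v - h (u + v)) ^ 2 / 2, where h is the support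
   function. Polarizing this expansion of the area shows that the mixed area is
   bilinear in the support functions, and nonnegative on V (L, .) for functions
   that are nonnegative on all triangles of normals (Caratheodory).

   Hence in V (K, L) V (M, N) <= V (K, M) V (L, N) + V (K, N) V (L, M) one may
   replace L by a triangle T, by unimodular invariance the standard one. If K,
   M, N have the same size with respect to T, this is the triangle inequality
   V (M, N) <= V (K, M) + V (K, N). Now V (T, T) - V (M, N) is a sum over the
   corners of T, and one may shrink K to the triangle of its touching points
   with T and enlarge M and N to hexagons with sides parallel to those of K and
   T, for which the claim is an explicit inequality between real numbers.

   Conversely, three segments and a hexagon with sides parallel to them realize
   all points with enough positive coordinates; the degenerate points are
   realized by four segments. *)

(** * Support functions and the Stern-Brocot tree *)

Section SternBrocot.
Context {R : realType}.
Implicit Types (u v w x y : R * R) (f g h : R * R -> R) (p q : R * R -> R * R).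

(** All bodies are tested on one fixed countable tree of directions, not on their own edges; this is
    what makes the expansion literally bilinear, with no common refinement to construct. Neighbours
    in the tree have determinant 1, so every triangle cut off is a unimodular image of a standard
    one.

    The contribution of one corner of T is the supremum of [gapsum] over the depth, and the proof
    needs only two opposite bounds for it. From above, [gapsum_le_gapw] replaces one body by the
    chord between its touching points, which leaves a single cut of the other body. From below,
    [gapw_le_gapsum] replaces each body by one cut, both in the same direction. The first bound
    serves (K, M) and (K, N), the second (M, N), always in the direction normal to the chord of K,
    so that all three involve the same few numbers.

    Sizes, chords and determinants of normals may vanish. The estimates are therefore stated with
    products, and quotients are formed only after the zero cases are removed. *)

Definition dot u v : R := u.1 * v.1 + u.2 * v.2.

Lemma dotDr u v w : dot u (v + w) = dot u v + dot u w.
Proof. by rewrite /dot /=; ring. Qed.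

Lemma dotZr u v t : dot u (t *: v) = t * dot u v.
Proof. by rewrite /dot /= /GRing.scale /=; ring. Qed.

Definition gap g u v := g u + g v - g (u + v).

Fixpoint gapsum n f g u v : R :=
  if n is n'.+1 then
    gap f u v * gap g u v + gapsum n' f g u (u + v) + gapsum n' f g (u + v) v
  else 0.

Lemma gapsumC n f g u v : gapsum n f g u v = gapsum n g f u v.
Proof.
by elim: n u v => [//|n IH] u v /=; rewrite !IH [gap f _ _ * _]mulrC.
Qed.

Lemma gapsumDr n f g g' u v :
  gapsum n f (fun w => g w + g' w) u v = gapsum n f g u v + gapsum n f g' u v.
Proof.
elim: n u v => [|n IH] u v /=; first by rewrite addr0.
by rewrite !IH /gap; ring.
Qed.

Lemma gapsumZr n f g c u v :
  gapsum n f (fun w => c * g w) u v = c * gapsum n f g u v.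
Proof.
elim: n u v => [|n IH] u v /=; first by rewrite mulr0.
by rewrite !IH /gap; ring.
Qed.

Lemma gapsum_dotr n f x u v : gapsum n f (dot x) u v = 0.
Proof.
elim: n u v => [//|n IH] u v /=; rewrite !IH /gap dotDr.
by rewrite subrr mulr0 !addr0.
Qed.

Definition sublinear f :=
  (forall u v, f (u + v) <= f u + f v) /\
  (forall t u, 0 <= t -> f (t *: u) = t * f u).

Lemma gap_ge0 f u v : sublinear f -> 0 <= gap f u v.
Proof. by move=> [sf _]; rewrite subr_ge0. Qed.

Lemma gapsum_ge0 n f g u v : sublinear f -> sublinear g -> 0 <= gapsum n f g u v.
Proof.
move=> sf sg; elim: n u v => [//|n IH] u v /=.
by rewrite !addr_ge0// mulr_ge0// gap_ge0.
Qed.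

Lemma gapsum_leS n f g u v : sublinear f -> sublinear g ->
  gapsum n f g u v <= gapsum n.+1 f g u v.
Proof.
move=> sf sg; elim: n u v => [|n IH] u v; first exact: gapsum_ge0.
by rewrite /= !lerD//; exact: IH.
Qed.

Lemma gapsum_le m n f g u v : sublinear f -> sublinear g -> (m <= n)%N ->
  gapsum m f g u v <= gapsum n f g u v.
Proof.
move=> sf sg /subnK <-; elim: (n - m)%N => [//|k IH].
by rewrite (le_trans IH)// addSn gapsum_leS.
Qed.

(* [p u] plays the role of a point of a convex body where [dot _ u] is maximal. *)
Definition tight p := forall u w, dot (p w) u <= dot (p u) u.

Definition supp p u := dot (p u) u.

Lemma supp_sublinear p : tight p -> sublinear (supp p).
Proof.
move=> tp; split=> [u v|t u t0]; first by rewrite /supp dotDr lerD.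
rewrite /supp dotZr; move: t0; rewrite le_eqVlt => /predU1P[<-|t0].
  by rewrite !mul0r.
congr (_ * _); apply/eqP; rewrite eq_le tp /=.
by have := tp (t *: u) u; rewrite !dotZr ler_pM2l.
Qed.

(* Up to the factor [1/2], the contribution to the mixed area of the part of
   the boundary of the polygon cut out by [u] and [v] that lies between the
   touching points [p u] and [p v]. *)
Definition arc p u v g :=
  (supp p v - dot (p u) v) * g u + (supp p u - dot (p v) u) * g v.

(** Inserting [u + v] splits an arc in two at the cost of one product of gaps: [arc p u v g] is that
    product plus the arcs of [(u, u + v)] and [(u + v, v)]. What is left at depth [n] is a sum over
    pieces of edges of the circumscribed polygon; the list holds their lengths, in units of the
    normals, and the normals. *)
Lemma arc_rep n p u v : tight p -> exists l : seq (R * (R * R)),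
  {in l, forall e, 0 <= e.1} /\
  forall g, arc p u v g - gapsum n (supp p) g u v = \sum_(e <- l) e.1 * g e.2.
Proof.
move=> tp; elim: n u v => [|n IH] u v.
  exists [:: (supp p v - dot (p u) v, u); (supp p u - dot (p v) u, v)].
  split=> [e|g]; last by rewrite !big_cons big_nil /= addr0 subr0.
  by rewrite !inE => /orP[]/eqP -> /=; rewrite subr_ge0 tp.
have [l1 [l1_ge0 l1E]] := IH u (u + v); have [l2 [l2_ge0 l2E]] := IH (u + v) v.
exists (l1 ++ l2); split=> [e|g].
  by rewrite mem_cat => /orP[/l1_ge0|/l2_ge0].
rewrite big_cat /= -l1E -l2E /arc /gap /supp !dotDr.
ring.
Qed.

Definition gapw f (a b : R) u v := a * f u + b * f v - f (a *: u + b *: v).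

(** With these weights [a *: u + b *: v] is normal to the chord from [p u] to [p v], so the
    right-hand side is the corner term of that chord. *)
Lemma gapsum_le_gapw n p q u v : tight p -> tight q ->
  gapsum n (supp p) (supp q) u v <=
  gapw (supp q) (supp p v - dot (p u) v) (supp p u - dot (p v) u) u v.
Proof.
move=> tp tq; have [l [l_ge0 lE]] := arc_rep n u v tp.
set a := _ - dot (p u) v; set b := _ - dot (p v) u.
pose y := q (a *: u + b *: v).
(* Translating [q] so that [y] becomes the origin makes its support function nonnegative and zero at
   the chord normal, while [gapsum] does not see the linear term. *)
have := lE (fun w => supp q w + (- 1) * dot y w).
rewrite gapsumDr gapsumZr gapsum_dotr mulr0 addr0.
have -> : arc p u v (fun w => supp q w + - 1 * dot y w) =
    gapw (supp q) a b u v.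
  rewrite /arc /gapw -/a -/b.
  have -> : supp q (a *: u + b *: v) = a * dot y u + b * dot y v.
    by rewrite {1}/supp dotDr !dotZr.
  by ring.
move=> E; rewrite -subr_ge0 E big_seq; apply: sumr_ge0 => e /l_ge0 e0.
by rewrite mulr_ge0// mulN1r subr_ge0 tq.
Qed.

Lemma gapw_ge0 f a b u v : sublinear f -> 0 <= a -> 0 <= b -> 0 <= gapw f a b u v.
Proof.
by move=> [sf hf] a0 b0; rewrite subr_ge0 (le_trans (sf _ _))// !hf.
Qed.

Lemma gapw_le f a b a' b' u v : sublinear f -> 0 <= a <= a' -> 0 <= b <= b' ->
  gapw f a b u v <= gapw f a' b' u v.
Proof.
move=> [sf hf] /andP[a0 aa'] /andP[b0 bb'].
have := sf (a *: u + b *: v) ((a' - a) *: u + (b' - b) *: v).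
have -> : a *: u + b *: v + ((a' - a) *: u + (b' - b) *: v) =
    a' *: u + b' *: v.
  by rewrite !scalerBl addrACA [a *: u + _]addrC [b *: v + _]addrC !subrK.
have := sf ((a' - a) *: u) ((b' - b) *: v).
rewrite !hf ?subr_ge0// /gapw.
lra.
Qed.

Lemma gapwZ f t a b u v : sublinear f -> 0 <= t ->
  gapw f (t * a) (t * b) u v = t * gapw f a b u v.
Proof.
move=> [sf hf] t0; rewrite /gapw -!scalerA -scalerDr hf//; ring.
Qed.

(* The Euclidean algorithm on [(a, b)] runs along the Stern-Brocot tree. *)
Lemma gapw_nat_le (a b : nat) f g u v : sublinear f -> sublinear g ->
  (0 < a)%N -> (0 < b)%N -> exists n,
  gapw f a%:R b%:R u v * gapw g a%:R b%:R u v <=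
  a%:R * b%:R * gapsum n f g u v.
Proof.
move=> sf sg.
have [k] := ubnP (a + b)%N; elim: k a b u v => // k IH a b u v abk a0 b0.
have aR : 0 < a%:R :> R by rewrite ltr0n.
have bR : 0 < b%:R :> R by rewrite ltr0n.
(* The induction step, for [a < b]: [c = a], [d = b - a], [x] and [x'] are the gaps of [f] and [g]
   at [(u, v)], [y] and [y'] the weighted gaps one level down, and [z] the sum over that subtree.
   The other subtree is dropped as nonnegative. *)
have final (c d x y x' y' z : R) : 0 < c -> 0 < d ->
    0 <= d * x - y -> 0 <= d * x' - y' -> y * y' <= c * d * z ->
  (c * x + y) * (c * x' + y') <= c * (c + d) * (x * x' + z).
  move=> c0 d0 h1 h2 h3.
  have P := mulr_ge0 h1 h2.
  rewrite -(ler_pM2l d0) -subr_ge0.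
  have -> : d * (c * (c + d) * (x * x' + z)) -
      d * ((c * x + y) * (c * x' + y')) =
    (c + d) * (c * d * z - y * y') + c * ((d * x - y) * (d * x' - y')) by ring.
  apply: addr_ge0; apply: mulr_ge0; lra.
have [ab|ba|ab] := ltngtP a b.
- have b'0 : (0 < b - a)%N by rewrite subn_gt0.
  have bE : b%:R = a%:R + (b - a)%:R :> R by rewrite -natrD subnKC// ltnW.
  have b'R : 0 < (b - a)%:R :> R by rewrite ltr0n.
  have [|n Hn] := IH a (b - a)%N (u + v) v _ a0 b'0.
    rewrite subnKC; last exact: ltnW.
    by rewrite -ltnS (leq_trans _ abk)// ltnS -[X in (X < _)%N]add0n ltn_add2r.
  exists n.+1.
  have key h : sublinear h -> gapw h a%:R b%:R u v =
      a%:R * gap h u v + gapw h a%:R (b - a)%:R (u + v) v /\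
      0 <= (b - a)%:R * gap h u v - gapw h a%:R (b - a)%:R (u + v) v.
    move=> [sh hh].
    have E : a%:R *: u + b%:R *: v = a%:R *: (u + v) + (b - a)%:R *: v.
      by rewrite bE scalerDl scalerDr addrA.
    split; first by rewrite /gapw E /gap bE; ring.
    have := sh (a%:R *: u + b%:R *: v) ((b - a)%:R *: u).
    have -> : a%:R *: u + b%:R *: v + (b - a)%:R *: u = b%:R *: (u + v).
      by rewrite bE scalerDr addrAC -scalerDl.
    rewrite !hh ?ler0n// /gapw E /gap => H.
    rewrite bE in H; nra.
  have [fE f0] := key f sf; have [gE g0] := key g sg.
  rewrite fE gE bE.
  apply: le_trans (final _ _ _ _ _ _ _ aR b'R f0 g0 Hn) _.
  rewrite ler_wpM2l//.
  by rewrite /= -addrA lerD2l lerDr gapsum_ge0.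
- have a'0 : (0 < a - b)%N by rewrite subn_gt0.
  have aE : a%:R = b%:R + (a - b)%:R :> R by rewrite -natrD subnKC// ltnW.
  have a'R : 0 < (a - b)%:R :> R by rewrite ltr0n.
  have [|n Hn] := IH (a - b)%N b u (u + v) _ a'0 b0.
    rewrite subnK; last exact: ltnW.
    by rewrite -ltnS (leq_trans _ abk)// ltnS -[X in (X < _)%N]addn0 ltn_add2l.
  exists n.+1.
  have key h : sublinear h -> gapw h a%:R b%:R u v =
      b%:R * gap h u v + gapw h (a - b)%:R b%:R u (u + v) /\
      0 <= (a - b)%:R * gap h u v - gapw h (a - b)%:R b%:R u (u + v).
    move=> [sh hh].
    have E : a%:R *: u + b%:R *: v = (a - b)%:R *: u + b%:R *: (u + v).
      by rewrite aE scalerDl scalerDr -addrA addrCA.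
    split; first by rewrite /gapw E /gap aE; ring.
    have := sh (a%:R *: u + b%:R *: v) ((a - b)%:R *: v).
    have -> : a%:R *: u + b%:R *: v + (a - b)%:R *: v = a%:R *: (u + v).
      by rewrite aE scalerDr -addrA -scalerDl.
    rewrite !hh ?ler0n// /gapw E /gap => H.
    rewrite aE in H; nra.
  have [fE f0] := key f sf; have [gE g0] := key g sg.
  rewrite fE gE aE [(b%:R + _) * b%:R]mulrC.
  rewrite [_%:R * b%:R * _](_ : _ = b%:R * (a - b)%:R * 
    gapsum n f g u (u + v)) in Hn; last by ring.
  apply: le_trans (final _ _ _ _ _ _ _ bR a'R f0 g0 Hn) _.
  rewrite ler_wpM2l//.
  by rewrite /= lerDl gapsum_ge0.
- exists 1%N; rewrite -ab /= !addr0.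
  have key h : sublinear h -> gapw h a%:R a%:R u v = a%:R * gap h u v.
    by move=> [_ hh]; rewrite /gapw -[_ *: u + _](scalerDr a%:R) hh ?ler0n// /gap; ring.
  rewrite !key//; rewrite le_eqVlt; apply/orP; left; apply/eqP; ring.
Qed.

Lemma ler_addinvn (a b c : R) : (forall n : nat, a <= b + c / n.+1%:R) -> a <= b.
Proof.
move=> H; rewrite leNgt; apply/negP => ba.
have c0 : 0 < c.
  by have := H 0%N; rewrite divr1; lra.
have d0 : 0 < a - b by rewrite subr_gt0.
have [n] : exists n : nat, c / (a - b) < n%:R.
  exists (Num.bound (c / (a - b))).
  by apply: le_lt_trans (archi_boundP _); rewrite // divr_ge0// ltW.
rewrite ltr_pdivrMr// => Hn.
have n0 : (0 : R) < n.+1%:R by rewrite ltr0n.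
have := H n; rewrite -lerBlDl ler_pdivlMr// => Hn'.
have : (a - b) * n%:R <= (a - b) * n.+1%:R by rewrite ler_wpM2l ?ler_nat// ltW.
rewrite mulrC in Hn; lra.
Qed.

Lemma nat_upper_approx (n : nat) (c : R) : 0 <= c -> exists m : nat,
  [/\ (0 < m)%N, c <= n.+1%:R^-1 * m%:R & n.+1%:R^-1 * m%:R <= c + n.+1%:R^-1].
Proof.
move=> c0; exists (Num.truncn (c * n.+1%:R)).+1.
have n0 : (0 : R) < n.+1%:R by rewrite ltr0n.
have cn : 0 <= c * n.+1%:R by rewrite mulr_ge0// ltW.
have /andP[t1 t2] := truncn_itv cn; split => //.
  by rewrite mulrC ler_pdivlMr// ltW.
rewrite mulrC ler_pdivrMr// mulrDl mulVf ?gt_eqF//.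
by rewrite -addn1 natrD lerD2r.
Qed.

(** If [u] and [v] have determinant 1, a cut of depth [d] with normal [a *: u + b *: v] removes a
    triangle of area [d ^+ 2 / (2 * a * b)]; this is the polarized form of saying that the whole
    tree removes at least as much. Real weights are approximated from above by fractions with a
    common denominator, since [gapw] grows with the weights. *)
Lemma gapw_le_gapsum (s a b : R) f g u v : sublinear f -> sublinear g ->
  0 <= a -> 0 <= b -> (forall n, gapsum n f g u v <= s) ->
  gapw f a b u v * gapw g a b u v <= a * b * s.
Proof.
move=> sf sg a0 b0 Hs.
have s0 : 0 <= s by exact: le_trans (Hs 0%N).
(* [(a + 1/n) * (b + 1/n)] exceeds [a * b] by at most [(a + b + 1) / n], because [1/n <= 1]. *)
apply: (@ler_addinvn _ _ ((a + b + 1) * s)) => N.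
set n := N.+1; have n0 : (0 : R) < n%:R by rewrite ltr0n.
have nV : 0 <= n%:R^-1 :> R by rewrite invr_ge0 ltW.
have nV1 : n%:R^-1 <= 1 :> R by rewrite invf_le1 // ler1n.
have [i [i0 ai ia]] := nat_upper_approx N a0.
have [j [j0 bj jb]] := nat_upper_approx N b0.
have [k] := gapw_nat_le u v sf sg i0 j0.
have le h : sublinear h -> gapw h a b u v <= n%:R^-1 * gapw h i%:R j%:R u v.
  by move=> sh; rewrite -gapwZ// gapw_le// ?a0 ?b0.
move=> H.
have : gapw f a b u v * gapw g a b u v <=
    (n%:R^-1 * gapw f i%:R j%:R u v) * (n%:R^-1 * gapw g i%:R j%:R u v).
  by rewrite ler_pM// ?gapw_ge0// le.
move=> /le_trans; apply.
have -> : n%:R^-1 * gapw f i%:R j%:R u v * (n%:R^-1 * gapw g i%:R j%:R u v) =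
  n%:R^-1 * n%:R^-1 * (gapw f i%:R j%:R u v * gapw g i%:R j%:R u v) by ring.
apply: (@le_trans _ _ (n%:R^-1 * n%:R^-1 * (i%:R * j%:R * s))).
  rewrite ler_wpM2l// ?mulr_ge0//; apply: le_trans H _.
  by rewrite ler_wpM2l.
have -> : n%:R^-1 * n%:R^-1 * (i%:R * j%:R * s) =
  (n%:R^-1 * i%:R) * (n%:R^-1 * j%:R) * s by ring.
have -> : a * b * s + (a + b + 1) * s / n%:R =
  (a * b + (a + b + 1) * n%:R^-1) * s by ring.
rewrite ler_wpM2r//.
apply: (@le_trans _ _ ((a + n%:R^-1) * (b + n%:R^-1))).
  by rewrite ler_pM// ?mulr_ge0.
have : n%:R^-1 * n%:R^-1 <= n%:R^-1 * 1 :> R by rewrite ler_wpM2l.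
by lra.
Qed.

End SternBrocot.

(** * The triangle inequality for hexagons *)

Section RealInequality.
Context {R : realFieldType}.
Implicit Types b x y t s : R.

(** Every pair among [t1], [t2], [t3] occurs in one inequality of [balanced], so at most one of the
    three is negative. The case analysis below rests on this. *)
Lemma cvx_ge0_lt0 b x y : 0 <= b <= 1 -> 0 <= b * x + (1 - b) * y -> y < 0 -> 0 <= x.
Proof.
move=> /andP[b0 b1] H y0; rewrite leNgt; apply/negP => x0.
have : 0 <= b * (- x) by rewrite mulr_ge0//; lra.
have : 0 <= (1 - b) * (- y) by rewrite mulr_ge0//; lra.
move=> P Q; have : b = 0 \/ 0 < b by lra.
case=> [b00|b00]; first by subst b; lra.
by have : 0 < b * (- x) by [rewrite mulr_gt0//; lra]; lra.
Qed.

(* A triangle of size 1 whose sides are divided in the ratios [b i : 1 - b i] by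
   the vertices of an inscribed triangle, and two hexagons obtained by cutting
   the corners along the sides of the inscribed triangle, scaled by [1 - t i]
   and [1 - s i]: this is the defect in the triangle inequality for their mixed
   areas. *)
Definition hexagon_defect b1 b2 b3 t1 t2 t3 s1 s2 s3 : R :=
  b1 * b2 * b3 + (1 - b1) * (1 - b2) * (1 - b3) +
  b1 * (1 - b2) * (t1 * s1) + b2 * (1 - b3) * (t2 * s2) +
  b3 * (1 - b1) * (t3 * s3).

(** The cuts [1 - t i] are nonnegative, and the two cuts at the ends of a common side do not
    overlap: on the first side they have lengths [b1 * (1 - t1)] and [(1 - b1) * (1 - t3)], with sum
    at most 1. *)
Definition balanced b1 b2 b3 t1 t2 t3 : Prop :=
  [/\ t1 <= 1, t2 <= 1 & t3 <= 1] /\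
  [/\ 0 <= b1 * t1 + (1 - b1) * t3, 0 <= b2 * t2 + (1 - b2) * t1 &
      0 <= b3 * t3 + (1 - b3) * t2].

(** Only the term with [t1 * s1] can be negative. [b1 * (1 - b2) * (- t1)] is at most [b1 * b2] and
    at most [(1 - b1) * (1 - b2)], hence at most their mean with weights [b3] and [1 - b3], which is
    the constant part of the defect. *)
Lemma hexagon_defect_ge0_1 b1 b2 b3 t1 t2 t3 s1 s2 s3 :
  0 <= b1 <= 1 -> 0 <= b2 <= 1 -> 0 <= b3 <= 1 ->
  balanced b1 b2 b3 t1 t2 t3 -> balanced b1 b2 b3 s1 s2 s3 ->
  t1 < 0 -> 0 <= s1 -> 0 <= s2 -> 0 <= s3 ->
  0 <= hexagon_defect b1 b2 b3 t1 t2 t3 s1 s2 s3.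
Proof.
move=> hb1 hb2 hb3 [[T1 T2 T3] [C1 C2 C3]] [[S1 S2 S3] _] t1_lt0 s1_ge0 s2_ge0 s3_ge0.
have t2_ge0 := cvx_ge0_lt0 hb2 C2 t1_lt0.
have t3_ge0 : 0 <= t3.
  rewrite leNgt; apply/negP => /(cvx_ge0_lt0 hb1 C1); lra.
move: hb1 hb2 hb3 => /andP[b10 b11] /andP[b20 b21] /andP[b30 b31].
have i1 : b1 * (- t1) <= 1 - b1.
  have : (1 - b1) * t3 <= (1 - b1) * 1 by rewrite ler_wpM2l//; lra.
  by lra.
have i2 : (1 - b2) * (- t1) <= b2.
  have : b2 * t2 <= b2 * 1 by rewrite ler_wpM2l.
  by lra.
have j1 : b1 * (1 - b2) * (- t1) <= (1 - b1) * (1 - b2).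
  have : b1 * (- t1) * (1 - b2) <= (1 - b1) * (1 - b2) by rewrite ler_wpM2r//; lra.
  by lra.
have j2 : b1 * (1 - b2) * (- t1) <= b1 * b2.
  have : b1 * ((1 - b2) * (- t1)) <= b1 * b2 by rewrite ler_wpM2l.
  by lra.
have k1 : (1 - b3) * (b1 * (1 - b2) * (- t1)) <= (1 - b3) * ((1 - b1) * (1 - b2)).
  by rewrite ler_wpM2l//; lra.
have k2 : b3 * (b1 * (1 - b2) * (- t1)) <= b3 * (b1 * b2) by rewrite ler_wpM2l.
have l : b1 * (1 - b2) * (- t1) * s1 <= b1 * (1 - b2) * (- t1) * 1.
  by rewrite ler_wpM2l// !mulr_ge0//; lra.
have m2 : 0 <= b2 * (1 - b3) * (t2 * s2) by rewrite !mulr_ge0//; lra.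
have m3 : 0 <= b3 * (1 - b1) * (t3 * s3) by rewrite !mulr_ge0//; lra.
rewrite /hexagon_defect; lra.
Qed.

(** If [e] and [f] have the same sign, both summands are nonnegative; otherwise the two bounds that
    are nonnegative multiply to exactly [- b * (1 - b) * (e * f)]. *)
Lemma opposite_slack b e f x y : 0 <= b -> 0 <= 1 - b ->
  b * e <= x -> (1 - b) * (- e) <= x -> b * f <= y -> (1 - b) * (- f) <= y ->
  0 <= x * y + b * (1 - b) * (e * f).
Proof.
move=> b0 c0 xe1 xe2 yf1 yf2.
have [e0|/ltW] := leP 0 e; last rewrite -oppr_ge0 => e0;
  (have [f0|/ltW] := leP 0 f; last rewrite -oppr_ge0 => f0).
- by rewrite addr_ge0 ?mulr_ge0// ?(le_trans _ xe1) ?(le_trans _ yf1)// mulr_ge0.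
- have : (b * e) * ((1 - b) * (- f)) <= x * y by rewrite ler_pM// mulr_ge0.
  by rewrite -subr_ge0; congr (0 <= _); ring.
- have : ((1 - b) * (- e)) * (b * f) <= x * y by rewrite ler_pM// mulr_ge0.
  by rewrite -subr_ge0; congr (0 <= _); ring.
- rewrite -[e * f]mulrNN; apply: addr_ge0; last by rewrite !mulr_ge0.
  by rewrite mulr_ge0// ?(le_trans _ xe2) ?(le_trans _ yf2)// mulr_ge0.
Qed.

(** Negative terms at two different corners: [x] and [y] bound their absolute values, [b] belongs to
    the side between these corners, and the positive term [p * r] of the third corner has to
    help. *)
Lemma opposite_cuts b1 b b3 p r x y :
  [/\ 0 <= b1, 0 <= b & 0 <= b3] -> [/\ 0 <= 1 - b1, 0 <= 1 - b & 0 <= 1 - b3] ->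
  0 <= p <= 1 -> 0 <= r <= 1 -> 0 <= x -> 0 <= y ->
  x <= b1 * b -> x <= (1 - b1) * (1 - b) * p ->
  y <= (1 - b) * (1 - b3) -> y <= b * b3 * r ->
  x + y <= b1 * b * b3 + (1 - b1) * (1 - b) * (1 - b3) + b3 * (1 - b1) * (p * r).
Proof.
move=> [b10 b0 b30] [c1 c c3] /andP[p0 p1] /andP[r0 r1] x0 y0 x1 x2 y1 y2.
have rhs0 : 0 <= b1 * b * b3 + (1 - b1) * (1 - b) * (1 - b3) +
    b3 * (1 - b1) * (p * r) by rewrite !addr_ge0// !mulr_ge0.
have [b_0|b_neq0] := eqVneq b 0.
  by rewrite b_0 mulr0 in x1; rewrite b_0 !mul0r in y2; lra.
have [b_1|b_neq1] := eqVneq (1 - b) 0.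
  by rewrite b_1 mulr0 mul0r in x2; rewrite b_1 !mul0r in y1; lra.
have d0 : 0 < b * (1 - b) by rewrite lt_neqAle eq_sym mulf_neq0// mulr_ge0.
have xy : x * y <= b * (1 - b) * (b3 * (1 - b1) * (p * r)).
  have -> : b * (1 - b) * (b3 * (1 - b1) * (p * r)) =
    ((1 - b1) * (1 - b) * p) * (b * b3 * r) by ring.
  by rewrite ler_pM.
have x3 : x <= (1 - b1) * (1 - b).
  by apply: le_trans x2 _; rewrite ler_piMr// mulr_ge0.
have y3 : y <= b * b3.
  by apply: le_trans y2 _; rewrite ler_piMr// mulr_ge0.
rewrite -(ler_pM2l d0) -subr_ge0.
(* The first bracket is nonnegative by [xy]; the second is [opposite_slack] for the slacks
   [b * (1 - b) - x] and [b * (1 - b) - y], with [e = 1 - b - b1] and [f = 1 - b - b3]. *)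
have -> : b * (1 - b) * (b1 * b * b3 + (1 - b1) * (1 - b) * (1 - b3) +
    b3 * (1 - b1) * (p * r)) - b * (1 - b) * (x + y) =
  (b * (1 - b) * (b3 * (1 - b1) * (p * r)) - x * y) +
  ((b * (1 - b) - x) * (b * (1 - b) - y) +
   b * (1 - b) * ((1 - b - b1) * (1 - b - b3))) by ring.
rewrite addr_ge0// ?subr_ge0// opposite_slack// lerBrDr addrC -lerBrDr.
- by apply: le_trans x1 _; rewrite le_eqVlt; apply/orP; left; apply/eqP; ring.
- by apply: le_trans x3 _; rewrite le_eqVlt; apply/orP; left; apply/eqP; ring.
- by apply: le_trans y3 _; rewrite le_eqVlt; apply/orP; left; apply/eqP; ring.
- by apply: le_trans y1 _; rewrite le_eqVlt; apply/orP; left; apply/eqP; ring.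
Qed.

Lemma hexagon_defect_ge0_2 b1 b2 b3 t1 t2 t3 s1 s2 s3 :
  0 <= b1 <= 1 -> 0 <= b2 <= 1 -> 0 <= b3 <= 1 ->
  balanced b1 b2 b3 t1 t2 t3 -> balanced b1 b2 b3 s1 s2 s3 ->
  t1 < 0 -> s2 < 0 ->
  0 <= hexagon_defect b1 b2 b3 t1 t2 t3 s1 s2 s3.
Proof.
move=> hb1 hb2 hb3 [[T1 T2 T3] [C1 C2 C3]] [[S1 S2 S3] [D1 D2 D3]] t1_lt0 s2_lt0.
have t2_ge0 := cvx_ge0_lt0 hb2 C2 t1_lt0.
have t3_ge0 : 0 <= t3.
  by rewrite leNgt; apply/negP => /(cvx_ge0_lt0 hb1 C1); rewrite leNgt t1_lt0.
have s3_ge0 := cvx_ge0_lt0 hb3 D3 s2_lt0.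
have s1_ge0 : 0 <= s1.
  by rewrite leNgt; apply/negP => /(cvx_ge0_lt0 hb2 D2); rewrite leNgt s2_lt0.
move: hb1 hb2 hb3 => /andP[b10] + /andP[b20] + /andP[b30].
rewrite -subr_ge0 -[b2 <= 1]subr_ge0 -[b3 <= 1]subr_ge0 => c1 c2 c3.
have nt1 : 0 <= - t1 by rewrite oppr_ge0 ltW.
have ns2 : 0 <= - s2 by rewrite oppr_ge0 ltW.
have i1 : b1 * (- t1) <= (1 - b1) * t3 by rewrite mulrN -subr_ge0 opprK addrC.
have i2 : (1 - b2) * (- t1) <= b2 * t2 by rewrite mulrN -subr_ge0 opprK.
have j2 : b2 * (- s2) <= (1 - b2) * s1 by rewrite mulrN -subr_ge0 opprK addrC.
have j3 : (1 - b3) * (- s2) <= b3 * s3 by rewrite mulrN -subr_ge0 opprK.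
have := @opposite_cuts b1 b2 b3 t3 s3 (b1 * (1 - b2) * (- t1))
  (b2 * (1 - b3) * (- s2)).
have ex : b1 * (1 - b2) * (- t1) * s1 <= b1 * (1 - b2) * (- t1).
  by rewrite ler_piMr// !mulr_ge0.
have ey : b2 * (1 - b3) * (- s2) * t2 <= b2 * (1 - b3) * (- s2).
  by rewrite ler_piMr// !mulr_ge0.
suff H : [/\ b1 * (1 - b2) * (- t1) <= b1 * b2,
    b1 * (1 - b2) * (- t1) <= (1 - b1) * (1 - b2) * t3,
    b2 * (1 - b3) * (- s2) <= (1 - b2) * (1 - b3) &
    b2 * (1 - b3) * (- s2) <= b2 * b3 * s3].
  case: H => h1 h2 h3 h4.
  move=> /(_ (And3 b10 b20 b30) (And3 c1 c2 c3)); rewrite t3_ge0 s3_ge0 T3 S3.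
  move=> /(_ isT isT) H; rewrite /hexagon_defect.
  have {}H := H (mulr_ge0 (mulr_ge0 b10 c2) nt1) (mulr_ge0 (mulr_ge0 b20 c3) ns2)
    h1 h2 h3 h4.
  by clear -H ex ey; lra.
split.
- by rewrite -mulrA ler_wpM2l// (le_trans i2)// ler_piMr.
- by rewrite mulrAC [X in _ <= X]mulrAC ler_wpM2r.
- rewrite mulrAC ler_wpM2r// (le_trans j2)// ler_piMr//.
- by rewrite -!mulrA ler_wpM2l.
Qed.

Lemma hexagon_defectC b1 b2 b3 t1 t2 t3 s1 s2 s3 :
  hexagon_defect b1 b2 b3 t1 t2 t3 s1 s2 s3 =
  hexagon_defect b1 b2 b3 s1 s2 s3 t1 t2 t3.
Proof. rewrite /hexagon_defect; ring. Qed.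

Lemma hexagon_defect_rot b1 b2 b3 t1 t2 t3 s1 s2 s3 :
  hexagon_defect b1 b2 b3 t1 t2 t3 s1 s2 s3 =
  hexagon_defect b2 b3 b1 t2 t3 t1 s2 s3 s1.
Proof. rewrite /hexagon_defect; ring. Qed.

Lemma balanced_rot b1 b2 b3 t1 t2 t3 :
  balanced b1 b2 b3 t1 t2 t3 -> balanced b2 b3 b1 t2 t3 t1.
Proof. by move=> [[? ? ?] [? ? ?]]. Qed.

Lemma hexagon_defect_ge0_lt0 b1 b2 b3 t1 t2 t3 s1 s2 s3 :
  0 <= b1 <= 1 -> 0 <= b2 <= 1 -> 0 <= b3 <= 1 ->
  balanced b1 b2 b3 t1 t2 t3 -> balanced b1 b2 b3 s1 s2 s3 ->
  t1 < 0 -> 0 <= hexagon_defect b1 b2 b3 t1 t2 t3 s1 s2 s3.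
Proof.
move=> hb1 hb2 hb3 Ht Hs t1_lt0.
have [s2_ge0|s2_lt0] := leP 0 s2; last exact: hexagon_defect_ge0_2.
have [s3_ge0|s3_lt0] := leP 0 s3; last first.
  (* Exchanging the hexagons and rotating twice moves the negative [s3] and [t1] to the first and
     second corner. *)
  rewrite hexagon_defectC hexagon_defect_rot hexagon_defect_rot.
  by apply: hexagon_defect_ge0_2 => //; do 2!apply: balanced_rot.
have [s1_ge0|s1_lt0] := leP 0 s1; first exact: hexagon_defect_ge0_1.
have [_ [C1 C2 C3]] := Ht.
have t2_ge0 := cvx_ge0_lt0 hb2 C2 t1_lt0.
have t3_ge0 : 0 <= t3.
  by rewrite leNgt; apply/negP => /(cvx_ge0_lt0 hb1 C1); lra.
move: hb1 hb2 hb3 => /andP[b10] + /andP[b20] + /andP[b30].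
rewrite -subr_ge0 -[b2 <= 1]subr_ge0 -[b3 <= 1]subr_ge0 => c1 c2 c3.
have ts1 : 0 <= t1 * s1 by rewrite -mulrNN mulr_ge0// oppr_ge0 ltW.
by rewrite /hexagon_defect; repeat first [done | apply: addr_ge0 | apply: mulr_ge0].
Qed.

Lemma hexagon_defect_ge0 b1 b2 b3 t1 t2 t3 s1 s2 s3 :
  0 <= b1 <= 1 -> 0 <= b2 <= 1 -> 0 <= b3 <= 1 ->
  balanced b1 b2 b3 t1 t2 t3 -> balanced b1 b2 b3 s1 s2 s3 ->
  0 <= hexagon_defect b1 b2 b3 t1 t2 t3 s1 s2 s3.
Proof.
move=> hb1 hb2 hb3 Ht Hs.
have one c1 c2 c3 x1 x2 x3 y1 y2 y3 : 0 <= c1 <= 1 -> 0 <= c2 <= 1 ->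
    0 <= c3 <= 1 -> balanced c1 c2 c3 x1 x2 x3 -> balanced c1 c2 c3 y1 y2 y3 ->
    (x1 < 0) || (y1 < 0) -> 0 <= hexagon_defect c1 c2 c3 x1 x2 x3 y1 y2 y3.
  move=> ? ? ? ? ? /orP[]?; first exact: hexagon_defect_ge0_lt0.
  by rewrite hexagon_defectC; exact: hexagon_defect_ge0_lt0.
have [ts1|] := boolP ((t1 < 0) || (s1 < 0)); first exact: one.
rewrite negb_or -!leNgt => /andP[t1_ge0 s1_ge0].
have [ts2|] := boolP ((t2 < 0) || (s2 < 0)).
  by rewrite hexagon_defect_rot; apply: one => //; apply: balanced_rot.
rewrite negb_or -!leNgt => /andP[t2_ge0 s2_ge0].
have [ts3|] := boolP ((t3 < 0) || (s3 < 0)).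
  rewrite 2!hexagon_defect_rot; apply: one => //; by do 2!apply: balanced_rot.
rewrite negb_or -!leNgt => /andP[t3_ge0 s3_ge0].
move: hb1 hb2 hb3 => /andP[b10 b11] /andP[b20 b21] /andP[b30 b31].
by rewrite /hexagon_defect !addr_ge0// !mulr_ge0//; lra.
Qed.

(* A corner of a triangle of size [m] cut off by a body: [d] is the depth of
   the cut with respect to weights [A] and [B], and [t] the ratio with the
   corresponding cut of a reference triangle of size [k]. *)
Lemma cut_ratio (A B k m d x y : R) : 0 <= A -> 0 <= B -> 0 < k -> 0 < m ->
  0 <= d -> d <= A * x -> d <= B * y -> 0 <= x -> 0 <= y ->
  exists t, [/\ 0 <= t, d * k = t * (A * B) * m, B * t * m <= k * x &
    A * t * m <= k * y].
Proof.
move=> A0 B0 k0 m0 d0 dx dy x0 y0.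
have [A00|A_gt0] : A = 0 \/ 0 < A by lra.
  have d_0 : d = 0 by move: dx; rewrite A00; lra.
  by exists 0; rewrite d_0 !(mulr0, mul0r) !(mulr_ge0 (ltW k0)).
have [B00|B_gt0] : B = 0 \/ 0 < B by lra.
  have d_0 : d = 0 by move: dy; rewrite B00; lra.
  by exists 0; rewrite d_0 !(mulr0, mul0r) !(mulr_ge0 (ltW k0)).
exists (d * k / (A * B * m)); split.
- by rewrite divr_ge0// !mulr_ge0// ltW.
- by field; rewrite !gt_eqF.
- have -> : B * (d * k / (A * B * m)) * m = k * (d / A).
    by field; rewrite !gt_eqF.
  by rewrite ler_pM2l// ler_pdivrMr// mulrC.
- have -> : A * (d * k / (A * B * m)) * m = k * (d / B).
    by field; rewrite !gt_eqF.
  by rewrite ler_pM2l// ler_pdivrMr// mulrC.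
Qed.

Lemma balanced_scaled (k M b t t' x : R) : 0 < k -> 0 < M ->
  k * b * t * M <= k * x -> k * (1 - b) * t' * M <= k * (M - x) ->
  0 <= b * (1 - t) + (1 - b) * (1 - t').
Proof.
move=> k0 M0 h1 h2; have kM : 0 < k * M by rewrite mulr_gt0.
have : k * M * (b * t + (1 - b) * t') <= k * M * 1 by lra.
by rewrite ler_pM2l//; lra.
Qed.

Lemma cut_product (k m n d e t r A B s : R) : 0 <= A -> 0 <= B -> 0 <= s ->
  d * k = t * (A * B) * m -> e * k = r * (A * B) * n -> d * e <= B * A * s ->
  t * r * (A * B) * (m * n) <= k ^+ 2 * s.
Proof.
move=> A0 B0 s0 dE eE deE.
have [->|AB_neq0] := eqVneq (A * B) 0.
  by rewrite mulr0 mul0r mulr_ge0// sqr_ge0.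
have AB_gt0 : 0 < A * B by rewrite lt_neqAle eq_sym AB_neq0 mulr_ge0.
rewrite -(ler_pM2l AB_gt0).
have -> : A * B * (t * r * (A * B) * (m * n)) = k ^+ 2 * (d * e).
  have -> : k ^+ 2 * (d * e) = (d * k) * (e * k) by ring.
  by rewrite dE eE; ring.
by rewrite [X in _ <= X]mulrCA ler_wpM2l ?sqr_ge0// [A * B]mulrC.
Qed.

(** The homogeneous form of [hexagon_defect_ge0] for sizes [k], [m], [n]. The ratios are
    [b i = B i / k]; [x i] and [y i] are the positions of the touching points of the other two
    bodies, [d i] and [e i] the depths of their cuts, and [s i] the bounds for their corner sums. *)
Lemma three_cuts (k m n A1 A2 A3 B1 B2 B3 d1 d2 d3 e1 e2 e3 x1 x2 x3 y1 y2 y3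
    s1 s2 s3 : R) :
  0 <= m -> 0 <= n ->
  [/\ 0 <= A1, 0 <= A2 & 0 <= A3] -> [/\ 0 <= B1, 0 <= B2 & 0 <= B3] ->
  [/\ B1 + A3 = k, B2 + A1 = k & B3 + A2 = k] ->
  [/\ 0 <= d1, 0 <= d2 & 0 <= d3] -> [/\ 0 <= e1, 0 <= e2 & 0 <= e3] ->
  [/\ 0 <= x1 <= m, 0 <= x2 <= m & 0 <= x3 <= m] ->
  [/\ 0 <= y1 <= n, 0 <= y2 <= n & 0 <= y3 <= n] ->
  [/\ d1 <= A1 * x1, d2 <= A2 * x2 & d3 <= A3 * x3] ->
  [/\ d1 <= B1 * (m - x2), d2 <= B2 * (m - x3) & d3 <= B3 * (m - x1)] ->
  [/\ e1 <= A1 * y1, e2 <= A2 * y2 & e3 <= A3 * y3] ->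
  [/\ e1 <= B1 * (n - y2), e2 <= B2 * (n - y3) & e3 <= B3 * (n - y1)] ->
  [/\ 0 <= s1, 0 <= s2 & 0 <= s3] ->
  [/\ d1 * e1 <= B1 * A1 * s1, d2 * e2 <= B2 * A2 * s2 & d3 * e3 <= B3 * A3 * s3] ->
  k * (m * n - (s1 + s2 + s3)) <=
  n * (k * m - (d1 + d2 + d3)) + m * (k * n - (e1 + e2 + e3)).
Proof.
move=> m0 n0 [A10 A20 A30] [B10 B20 B30] [E1 E2 E3] [d10 d20 d30] [e10 e20 e30].
move=> [/andP[x10 x1m] /andP[x20 x2m] /andP[x30 x3m]].
move=> [/andP[y10 y1n] /andP[y20 y2n] /andP[y30 y3n]].
move=> [dA1 dA2 dA3] [dB1 dB2 dB3] [eA1 eA2 eA3] [eB1 eB2 eB3].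
move=> [s10 s20 s30] [S1 S2 S3].
have k0 : 0 <= k by rewrite -E1 addr_ge0.
(* When a size vanishes, so do the depths that it bounds; these cases go first because the ratios
   divide by the sizes. *)
have [k_0|k_gt0] : k = 0 \/ 0 < k by lra.
  have [A1_0 [A2_0 A3_0]] : A1 = 0 /\ A2 = 0 /\ A3 = 0 by lra.
  rewrite A1_0 A2_0 A3_0 !mul0r in dA1 dA2 dA3 eA1 eA2 eA3.
  have -> : d1 + d2 + d3 = 0 by lra.
  have -> : e1 + e2 + e3 = 0 by lra.
  by rewrite k_0 !mul0r !subr0 !mulr0 addr0.
have ks : 0 <= k * (s1 + s2 + s3) by rewrite mulr_ge0// !addr_ge0.
have [m_0|m_gt0] : m = 0 \/ 0 < m by lra.
  have [x1_0 [x2_0 x3_0]] : x1 = 0 /\ x2 = 0 /\ x3 = 0 by lra.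
  rewrite x1_0 x2_0 x3_0 !mulr0 in dA1 dA2 dA3.
  have -> : d1 + d2 + d3 = 0 by lra.
  rewrite m_0; clear -ks; lra.
have [n_0|n_gt0] : n = 0 \/ 0 < n by lra.
  have [y1_0 [y2_0 y3_0]] : y1 = 0 /\ y2 = 0 /\ y3 = 0 by lra.
  rewrite y1_0 y2_0 y3_0 !mulr0 in eA1 eA2 eA3.
  have -> : e1 + e2 + e3 = 0 by lra.
  rewrite n_0; clear -ks; lra.
have [|t1 [t10 td1 tB1 tA1]] := cut_ratio A10 B10 k_gt0 m_gt0 d10 dA1 dB1 x10.
  by rewrite subr_ge0.
have [|t2 [t20 td2 tB2 tA2]] := cut_ratio A20 B20 k_gt0 m_gt0 d20 dA2 dB2 x20.
  by rewrite subr_ge0.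
have [|t3 [t30 td3 tB3 tA3]] := cut_ratio A30 B30 k_gt0 m_gt0 d30 dA3 dB3 x30.
  by rewrite subr_ge0.
have [|r1 [r10 re1 rB1 rA1]] := cut_ratio A10 B10 k_gt0 n_gt0 e10 eA1 eB1 y10.
  by rewrite subr_ge0.
have [|r2 [r20 re2 rB2 rA2]] := cut_ratio A20 B20 k_gt0 n_gt0 e20 eA2 eB2 y20.
  by rewrite subr_ge0.
have [|r3 [r30 re3 rB3 rA3]] := cut_ratio A30 B30 k_gt0 n_gt0 e30 eA3 eB3 y30.
  by rewrite subr_ge0.
have split_k B A : B + A = k -> exists b, B = k * b /\ A = k * (1 - b).
  by move=> BA; exists (B / k); split; [|rewrite mulrBr mulr1];
    rewrite mulrC divfK ?gt_eqF// -BA addrAC subrr add0r.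
have [b1 [B1E A3E]] := split_k _ _ E1.
have [b2 [B2E A1E]] := split_k _ _ E2.
have [b3 [B3E A2E]] := split_k _ _ E3.
have pk z : 0 <= k * z -> 0 <= z by rewrite pmulr_rge0.
have hb1 : 0 <= b1 <= 1 by rewrite pk -?B1E// -subr_ge0 pk -?A3E.
have hb2 : 0 <= b2 <= 1 by rewrite pk -?B2E// -subr_ge0 pk -?A1E.
have hb3 : 0 <= b3 <= 1 by rewrite pk -?B3E// -subr_ge0 pk -?A2E.
have bal : balanced b1 b2 b3 (1 - t1) (1 - t2) (1 - t3).
  rewrite B1E B2E B3E A1E A2E A3E in tA1 tB1 tA2 tB2 tA3 tB3.
  split; first by rewrite !gerBl.
  by split; [apply: balanced_scaled k_gt0 m_gt0 tB1 tA3
            |apply: balanced_scaled k_gt0 m_gt0 tB2 tA1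
            |apply: balanced_scaled k_gt0 m_gt0 tB3 tA2].
have bal' : balanced b1 b2 b3 (1 - r1) (1 - r2) (1 - r3).
  rewrite B1E B2E B3E A1E A2E A3E in rA1 rB1 rA2 rB2 rA3 rB3.
  split; first by rewrite !gerBl.
  by split; [apply: balanced_scaled k_gt0 n_gt0 rB1 rA3
            |apply: balanced_scaled k_gt0 n_gt0 rB2 rA1
            |apply: balanced_scaled k_gt0 n_gt0 rB3 rA2].
have H := hexagon_defect_ge0 hb1 hb2 hb3 bal bal'.
have P1 := cut_product A10 B10 s10 td1 re1 S1.
have P2 := cut_product A20 B20 s20 td2 re2 S2.
have P3 := cut_product A30 B30 s30 td3 re3 S3.
rewrite -(ler_pM2l k_gt0) -subr_ge0.
have -> : k * (n * (k * m - (d1 + d2 + d3)) + m * (k * n - (e1 + e2 + e3))) -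
    k * (k * (m * n - (s1 + s2 + s3))) =
  k ^+ 2 * (m * n) - n * (d1 * k + d2 * k + d3 * k) - m * (e1 * k + e2 * k + e3 * k)
  + (k ^+ 2 * s1 + k ^+ 2 * s2 + k ^+ 2 * s3) by ring.
rewrite td1 td2 td3 re1 re2 re3.
have {}H : 0 <= k ^+ 2 * (m * n) * hexagon_defect b1 b2 b3
    (1 - t1) (1 - t2) (1 - t3) (1 - r1) (1 - r2) (1 - r3).
  by rewrite !mulr_ge0// sqr_ge0.
apply: le_trans H _; move: P1 P2 P3; rewrite /hexagon_defect.
rewrite A1E A2E A3E B1E B2E B3E; clear; lra.
Qed.

End RealInequality.

(** * Fans of directions *)

Section Fans.
Context {R : realType}.
Implicit Types (u v w x y : R * R) (f g h : R * R -> R) (p q r : R * R -> R * R).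

Lemma gapw_le_touch q a b u v w : tight q ->
  gapw (supp q) a b u v <=
  a * (supp q u - dot (q w) u) + b * (supp q v - dot (q w) v).
Proof.
move=> tq; have := tq (a *: u + b *: v) w.
by rewrite -/(supp q _) /gapw dotDr !dotZr; lra.
Qed.

(** For [u + v + w = 0] this is twice the mixed area with the triangle whose edge vectors are [u],
    [v], [w] turned by a right angle. *)
Definition fan_size p u v w := supp p u + supp p v + supp p w.

(** How deep the support line of [q] normal to the chord from [p u] to [p v] cuts into the corner of
    [q]. *)
Definition fan_depth p q u v :=
  gapw (supp q) (supp p v - dot (p u) v) (supp p u - dot (p v) u) u v.

Lemma dot0r u : dot u 0 = 0.
Proof. by rewrite /dot !mulr0 addr0. Qed.

(** A support line cuts no deeper than any point of the body lies; testing this at the touching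
    points with the two sides of a corner gives the bounds on the depths that [three_cuts] asks
    for. *)
Lemma fan_plucker p q r u1 u2 u3 (s12 s23 s31 : R) :
  tight p -> tight q -> tight r -> u1 + u2 + u3 = 0 ->
  (forall n, gapsum n (supp q) (supp r) u1 u2 <= s12) ->
  (forall n, gapsum n (supp q) (supp r) u2 u3 <= s23) ->
  (forall n, gapsum n (supp q) (supp r) u3 u1 <= s31) ->
  fan_size p u1 u2 u3 * (fan_size q u1 u2 u3 * fan_size r u1 u2 u3 -
    (s12 + s23 + s31)) <=
  fan_size r u1 u2 u3 * (fan_size p u1 u2 u3 * fan_size q u1 u2 u3 -
    (fan_depth p q u1 u2 + fan_depth p q u2 u3 + fan_depth p q u3 u1)) +
  fan_size q u1 u2 u3 * (fan_size p u1 u2 u3 * fan_size r u1 u2 u3 -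
    (fan_depth p r u1 u2 + fan_depth p r u2 u3 + fan_depth p r u3 u1)).
Proof.
move=> tp tq tr u0 h12 h23 h31.
pose k := fan_size p u1 u2 u3; pose m := fan_size q u1 u2 u3.
pose n := fan_size r u1 u2 u3.
have sq := supp_sublinear tq; have sr := supp_sublinear tr.
have dot_sum x : dot x u1 + dot x u2 + dot x u3 = 0.
  by rewrite -!dotDr u0 dot0r.
have pos p' w w' : tight p' -> 0 <= supp p' w - dot (p' w') w.
  by move=> t'; rewrite subr_ge0 t'.
have szE p' w : fan_size p' u1 u2 u3 = (supp p' u1 - dot (p' w) u1) +
    (supp p' u2 - dot (p' w) u2) + (supp p' u3 - dot (p' w) u3).
  by rewrite /fan_size; have := dot_sum (p' w); lra.
have zero p' w : supp p' w - dot (p' w) w = 0 by rewrite subrr.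
have sz0 p' : tight p' -> 0 <= fan_size p' u1 u2 u3.
  by move=> t'; rewrite (szE _ u1); apply: addr_ge0; first apply: addr_ge0; exact: pos.
have at_touch p' a b w w' v : tight p' ->
    gapw (supp p') a b w w' <= a * (supp p' w - dot (p' v) w) +
      b * (supp p' w' - dot (p' v) w').
  by move=> t'; exact: gapw_le_touch.
have depthA p' w w' : tight p' -> fan_depth p p' w w' <=
    (supp p w - dot (p w') w) * (supp p' w' - dot (p' w) w').
  by move=> t'; apply: le_trans (at_touch _ _ _ _ _ w t') _; rewrite zero mulr0 add0r.
have depthB p' w w' : tight p' -> fan_depth p p' w w' <=
    (supp p w' - dot (p w) w') * (supp p' w - dot (p' w') w).
  by move=> t'; apply: le_trans (at_touch _ _ _ _ _ w' t') _; rewrite zero mulr0 addr0.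
have le_sz p' : tight p' -> [/\
    0 <= supp p' u2 - dot (p' u1) u2 <= fan_size p' u1 u2 u3,
    0 <= supp p' u3 - dot (p' u2) u3 <= fan_size p' u1 u2 u3 &
    0 <= supp p' u1 - dot (p' u3) u1 <= fan_size p' u1 u2 u3].
  move=> t'; rewrite !pos//=; split.
  - rewrite (szE _ u1) zero add0r lerDl pos//.
  - rewrite (szE _ u2) zero addr0 lerDr pos//.
  - rewrite (szE _ u3) zero addr0 lerDl pos//.
have opp p' : tight p' -> [/\
   fan_size p' u1 u2 u3 - (supp p' u3 - dot (p' u2) u3) = supp p' u1 - dot (p' u2) u1,
   fan_size p' u1 u2 u3 - (supp p' u1 - dot (p' u3) u1) = supp p' u2 - dot (p' u3) u2 &
   fan_size p' u1 u2 u3 - (supp p' u2 - dot (p' u1) u2) = supp p' u3 - dot (p' u1) u3].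
  move=> t'; split.
  - by rewrite (szE _ u2) zero addr0 addrK.
  - by rewrite (szE _ u3) zero addr0 addrC addrA [- _ + _]addrC subrr add0r.
  - by rewrite (szE _ u1) zero add0r addrAC subrr add0r.
have [q1 q2 q3] := opp q tq; have [r1 r2 r3] := opp r tr.
have [p1 p2 p3] := opp p tp.
apply: (@three_cuts _ k m n (supp p u1 - dot (p u2) u1) (supp p u2 - dot (p u3) u2)
  (supp p u3 - dot (p u1) u3) (supp p u2 - dot (p u1) u2) (supp p u3 - dot (p u2) u3)
  (supp p u1 - dot (p u3) u1) (fan_depth p q u1 u2) (fan_depth p q u2 u3)
  (fan_depth p q u3 u1) (fan_depth p r u1 u2) (fan_depth p r u2 u3)
  (fan_depth p r u3 u1)
  (supp q u2 - dot (q u1) u2) (supp q u3 - dot (q u2) u3) (supp q u1 - dot (q u3) u1)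
  (supp r u2 - dot (r u1) u2) (supp r u3 - dot (r u2) u3) (supp r u1 - dot (r u3) u1)).
- exact: sz0.
- exact: sz0.
- by rewrite !pos.
- by rewrite !pos.
- by rewrite -p1 -p2 -p3; split; rewrite addrC subrK.
- by split; apply: gapw_ge0 => //; exact: pos.
- by split; apply: gapw_ge0 => //; exact: pos.
- exact: le_sz.
- exact: le_sz.
- by split; exact: depthA.
- by rewrite /m q1 q2 q3; split; exact: depthB.
- by split; exact: depthA.
- by rewrite /n r1 r2 r3; split; exact: depthB.
- by split; [exact: le_trans (h12 0%N)|exact: le_trans (h23 0%N)|exact: le_trans (h31 0%N)].
- by split; apply: gapw_le_gapsum => //; exact: pos.
Qed.

(** * Bilinear expansion of the mixed area over the four quadrants *)

Definition e1 : R * R := (1, 0).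
Definition e2 : R * R := (0, 1).

(** For support functions this decreases with [n] to twice the mixed area. The form by arcs yields
    the representation by edges; around the four quadrants the terms with touching points cancel,
    which leaves the symmetric form [mixed_approxE]. *)
Definition mixed_approx n p g :=
  (arc p e1 e2 g - gapsum n (supp p) g e1 e2) +
  (arc p e2 (- e1) g - gapsum n (supp p) g e2 (- e1)) +
  (arc p (- e1) (- e2) g - gapsum n (supp p) g (- e1) (- e2)) +
  (arc p (- e2) e1 g - gapsum n (supp p) g (- e2) e1).

Lemma dotNr u v : dot u (- v) = - dot u v.
Proof. by rewrite /dot /= !mulrN opprD. Qed.

Lemma mixed_approxE n p g : mixed_approx n p g =
  (supp p e2 + supp p (- e2)) * (g e1 + g (- e1)) +
  (supp p e1 + supp p (- e1)) * (g e2 + g (- e2)) -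
  (gapsum n (supp p) g e1 e2 + gapsum n (supp p) g e2 (- e1) +
   gapsum n (supp p) g (- e1) (- e2) + gapsum n (supp p) g (- e2) e1).
Proof.
rewrite /mixed_approx /arc /supp !dotNr; ring.
Qed.

Lemma mixed_approxD n p g g' : mixed_approx n p (fun w => g w + g' w) =
  mixed_approx n p g + mixed_approx n p g'.
Proof. by rewrite !mixed_approxE !gapsumDr; ring. Qed.

Lemma mixed_approxZ n p c g : mixed_approx n p (fun w => c * g w) =
  c * mixed_approx n p g.
Proof. by rewrite !mixed_approxE !gapsumZr; ring. Qed.

Lemma mixed_approxC n p q :
  mixed_approx n p (supp q) = mixed_approx n q (supp p).
Proof. by rewrite !mixed_approxE ![gapsum n (supp p) _ _ _]gapsumC; ring. Qed.

Lemma mixed_approx_dot n p x : mixed_approx n p (dot x) = 0.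
Proof. by rewrite mixed_approxE !gapsum_dotr !dotNr; ring. Qed.

(** The list consists of edge normals scaled by edge lengths, which homogeneity of [g] allows. They
    sum to zero because the expansion vanishes on linear functions. *)
Lemma mixed_approx_rep n p : tight p -> exists l : seq (R * R),
  \sum_(w <- l) w = 0 /\
  forall g, (forall (t : R) u, 0 <= t -> g (t *: u) = t * g u) ->
    mixed_approx n p g = \sum_(w <- l) g w.
Proof.
move=> tp.
have [l1 [l1_ge0 l1E]] := arc_rep n e1 e2 tp.
have [l2 [l2_ge0 l2E]] := arc_rep n e2 (- e1) tp.
have [l3 [l3_ge0 l3E]] := arc_rep n (- e1) (- e2) tp.
have [l4 [l4_ge0 l4E]] := arc_rep n (- e2) e1 tp.
pose l := l1 ++ l2 ++ l3 ++ l4.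
have l_ge0 : {in l, forall e, 0 <= e.1}.
  by move=> e; rewrite !mem_cat => /or4P[/l1_ge0|/l2_ge0|/l3_ge0|/l4_ge0].
have lE g : mixed_approx n p g = \sum_(e <- l) e.1 * g e.2.
  by rewrite /mixed_approx l1E l2E l3E l4E !big_cat /= !addrA.
exists [seq e.1 *: e.2 | e <- l]; rewrite big_map; split; last first.
  move=> g hg; rewrite lE big_map big_seq [RHS]big_seq.
  by apply: eq_bigr => e /l_ge0 e0; rewrite hg.
have dotE x : dot x (\sum_(e <- l) e.1 *: e.2) = 0.
  rewrite -(mixed_approx_dot n p x) lE.
  elim: (l) => [|e s IH]; first by rewrite !big_nil dot0r.
  by rewrite !big_cons dotDr dotZr IH.
have := dotE e1; have := dotE e2; rewrite /dot /= !mul1r !mul0r add0r addr0.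
by case: (\sum_(e <- l) _) => a b /= -> ->.
Qed.

(** * Reduction to triangles of normals *)

Definition triangle_ge0 g :=
  forall u v w, u + v + w = 0 -> 0 <= g u + g v + g w.

Lemma dependency3 (a b c : 'I_4 -> R) : exists t : 'I_4 -> R,
  [/\ exists i, t i != 0, \sum_i t i * a i = 0, \sum_i t i * b i = 0 &
      \sum_i t i * c i = 0].
Proof.
pose M : 'M[R]_(4, 3) := \matrix_(i, j) nth 0 [:: a i; b i; c i] j.
have : kermx M != 0.
  by rewrite kermx_eq0 -row_leq_rank -ltnNge (leq_ltn_trans (rank_leq_col M)).
move=> /rowV0Pn[v /sub_kermxP vM v0].
have E j : \sum_i v 0 i * M i j = 0 by have /matrixP/(_ 0 j) := vM; rewrite !mxE.
exists (v 0); split.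
- by apply/existsP; apply: contraNT v0 => /existsPn H; apply/eqP/rowP => i;
    rewrite mxE; have /negPn/eqP := H i.
- by apply: etrans (E 0); apply: eq_bigr => i _; rewrite mxE.
- by apply: etrans (E (lift 0 0)); apply: eq_bigr => i _; rewrite mxE.
- by apply: etrans (E (lift 0 (lift 0 0))); apply: eq_bigr => i _; rewrite mxE.
Qed.

(** Four vectors [(w, g w)] in a space of dimension 3 are dependent. Subtracting a multiple of the
    dependency rescales the four [w] by nonnegative factors, preserves both sums and removes one
    vector; lists of at most three vectors are padded with 0. *)
Lemma triangle_ge0_sum g (l : seq (R * R)) :
  (forall (t : R) u, 0 <= t -> g (t *: u) = t * g u) -> triangle_ge0 g ->
  \sum_(w <- l) w = 0 -> 0 <= \sum_(w <- l) g w.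
Proof.
move=> hg tg; have g0 : g 0 = 0 by rewrite -(scale0r 0) hg// mul0r.
have [k] := ubnP (size l); elim: k l => // k IH [|w0 [|w1 [|w2 [|w3 l]]]] lk;
    rewrite ?(big_nil, big_cons) ?addr0 => E //.
- by have := tg w0 0 0; rewrite g0 !addr0; exact.
- by have := tg w0 w1 0; rewrite g0 !addr0; exact.
- by rewrite addrA tg// -addrA.
pose w (i : 'I_4) := nth 0 [:: w0; w1; w2; w3] i.
have sumw (T : nmodType) (F : R * R -> T) :
    F w0 + (F w1 + (F w2 + (F w3 + \sum_(v <- l) F v))) =
    \sum_i F (w i) + \sum_(v <- l) F v.
  by rewrite !big_ord_recl big_ord0 /w /= addr0 !addrA.
rewrite sumw; rewrite (sumw _ id) in E.
have [t [t0 t1 t2 tg0]] :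
    exists t : 'I_4 -> R, [/\ exists i, 0 < t i, \sum_i t i * (w i).1 = 0,
      \sum_i t i * (w i).2 = 0 & \sum_i t i * g (w i) = 0].
  have [t [[i ti] t1 t2 tg0]] := dependency3 (fst \o w) (snd \o w) (g \o w).
  move: ti; rewrite neq_lt => /orP[ti|ti]; last by exists t; split => //; exists i.
  exists (fun i => - t i); split; first by exists i; rewrite oppr_gt0.
  - by under eq_bigr do rewrite mulNr; rewrite sumrN t1 oppr0.
  - by under eq_bigr do rewrite mulNr; rewrite sumrN t2 oppr0.
  - by under eq_bigr do rewrite mulNr; rewrite sumrN tg0 oppr0.
(* The largest coefficient is the one to cancel: then all factors [c j] are nonnegative. *)
have [i ti tmax] : exists2 i, 0 < t i & forall j, t j <= t i.
  have [i0 ti0] := t0.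
  case: (arg_maxP t (erefl : xpredT i0)) => i _ H; exists i => [|j]; last exact: H.
  by apply: lt_le_trans ti0 _; exact: H.
pose c j := 1 - t j / t i.
have c0 j : 0 <= c j by rewrite subr_ge0 ler_pdivrMr// mul1r.
have ci : c i = 0 by rewrite /c divff ?gt_eqF// subrr.
have -> : \sum_j g (w j) = \sum_(j in predC1 i) g (c j *: w j).
  transitivity (\sum_j c j * g (w j)).
    under [RHS]eq_bigr do rewrite mulrBl mul1r mulrAC.
    by rewrite sumrB -mulr_suml tg0 mul0r subr0.
  rewrite (bigD1 i)//= ci mul0r add0r.
  by apply: eq_bigr => j _; rewrite hg.
have {}E : \sum_(j in predC1 i) c j *: w j + \sum_(v <- l) v = 0.
  rewrite -[RHS]E; congr (_ + _).
  have Z : \sum_j t j *: w j = 0.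
    rewrite [LHS]surjective_pairing.
    rewrite (raddf_sum fst) (raddf_sum snd) /=.
    by rewrite t1 t2.
  transitivity (\sum_j c j *: w j); first by rewrite [RHS](bigD1 i)//= ci scale0r add0r.
  under eq_bigr do rewrite scalerBl scale1r mulrC -scalerA.
  by rewrite sumrB -scaler_sumr Z scaler0 subr0.
have := IH ([seq c j *: w j | j in predC1 i] ++ l).
rewrite !big_cat !big_image size_cat size_image cardC1 card_ord.
by apply=> //; rewrite -ltnS.
Qed.

Lemma mixed_approx_ge0 n p g : tight p ->
  (forall (t : R) u, 0 <= t -> g (t *: u) = t * g u) -> triangle_ge0 g ->
  0 <= mixed_approx n p g.
Proof.
move=> tp hg tg; have [l [l0 lE]] := mixed_approx_rep n tp.
by rewrite lE// triangle_ge0_sum.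
Qed.

Lemma supp_triangle_ge0 p : tight p -> triangle_ge0 (supp p).
Proof.
move=> tp u v w uvw.
have -> : 0 = dot (p u) u + dot (p u) v + dot (p u) w by rewrite -!dotDr uvw dot0r.
by apply: lerD; first apply: lerD; exact: tp.
Qed.

Lemma mixed_approx_leS n p q : tight p -> tight q ->
  mixed_approx n.+1 p (supp q) <= mixed_approx n p (supp q).
Proof.
move=> tp tq; rewrite !mixed_approxE lerD2l lerN2.
by rewrite !lerD// gapsum_leS//; exact: supp_sublinear.
Qed.

End Fans.

(** * Area of polygons *)

Section PlaneMeasure.
Context {R : realType}.
Implicit Types (u v w : R * R).

Notation lambda := (@lebesgue_measure R).
Notation mu := (lambda \x lambda)%E.
Notation plane := (measurableTypeR R * measurableTypeR R)%type.

(** * Area under unimodular maps, and the standard triangle *)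

Lemma lebesgue_measure_shift (c : R) (A : set (measurableTypeR R)) :
  measurable A -> lambda ((fun y : R => y + c) @^-1` A) = lambda A.
Proof.
move=> mA; have mf : measurable_fun [set: measurableTypeR R]
    ((fun y => y + c) : measurableTypeR R -> measurableTypeR R).
  exact: measurable_funD.
pose m' := pushforward lambda (fun y : measurableTypeR R => (y + c : measurableTypeR R)).
rewrite (@lebesgue_measure_unique R m' _ A mA) => // X [[a b] _ <-] /=.
rewrite /m' /pushforward /=.
have -> : (fun y : R => y + c) @^-1` `]a, b] = `]a - c, b - c]%classic.
  by apply/seteqP; split => y /=; rewrite !in_itv/= ltrBlDr lerBrDr.
rewrite !lebesgue_measure_itv /= !lte_fin ltrD2r.
by case: ifP => // _; rewrite -!EFinD; congr (_%:E); ring.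
Qed.

Lemma shear_snd (c : R) (A : set plane) : measurable A ->
  mu [set z | A (z.1, z.2 + c * z.1)] = mu A.
Proof.
move=> mA; apply: eq_integral => x _ /=.
rewrite -(lebesgue_measure_shift (c * x) (measurable_xsection x mA)).
by congr (lambda _); apply/seteqP; split => y; rewrite /xsection /= !inE.
Qed.

(** Exchanges the order of slicing: a shear of the first coordinate acts by translations only on
    slices with fixed second coordinate. *)
Lemma product_measure21 (A : set plane) : measurable A ->
  mu A = (lambda \x^ lambda)%E A.
Proof.
move=> mA.
by apply: (@product_measure_unique _ _ _ _ R lambda lambda (lambda \x^ lambda)%E) => //;
  exact: product_measure2E.
Qed.

Lemma measurable_dot u : measurable_fun [set: plane] ((fun z => dot z u) : plane -> R).
Proof.
have m1 : measurable_fun [set: plane] (fst : plane -> R) by exact: measurable_fst.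
have m2 : measurable_fun [set: plane] (snd : plane -> R) by exact: measurable_snd.
by apply: measurable_funD; exact: measurable_funM.
Qed.

Lemma measurable_dot2 u v : measurable_fun [set: plane]
  ((fun z => (dot z u, dot z v)) : plane -> plane).
Proof. by apply: measurable_fun_pair; exact: measurable_dot. Qed.

Lemma measurable_dot2_preimage u v (A : set plane) : measurable A ->
  measurable ([set z | A (dot z u, dot z v)] : set plane).
Proof.
by move=> mA; rewrite -[X in measurable X]setTI; exact: measurable_dot2.
Qed.

Lemma measurable_linear_preimage u v (f : R * R -> R * R) (A : set plane) :
  (forall z, f z = (dot z u, dot z v)) -> measurable A ->
  measurable ([set z | A (f z)] : set plane).
Proof.
move=> fE /(measurable_dot2_preimage u v); congr measurable.
by apply: funext => z /=; rewrite fE.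
Qed.

Lemma measurable_halfplane u (c : R) : measurable ([set z | dot z u <= c] : set plane).
Proof.
rewrite -[X in measurable X]setTI.
have -> : [set z | dot z u <= c] = (fun z => dot z u) @^-1` `]-oo, c]%classic.
  by apply/seteqP; split => z; rewrite /= in_itv.
exact: measurable_dot.
Qed.

Lemma shear_fst (c : R) (A : set plane) : measurable A ->
  mu [set z | A (z.1 + c * z.2, z.2)] = mu A.
Proof.
move=> mA.
have mB : measurable ([set z | A (z.1 + c * z.2, z.2)] : set plane).
  apply: (@measurable_linear_preimage (1, c) (0, 1) (fun z => (_, _))) mA.
  by move=> z; rewrite /dot /=; congr (_, _); ring.
rewrite !product_measure21//; apply: eq_integral => y _ /=.
rewrite -(lebesgue_measure_shift (c * y) (measurable_ysection y mA)).
by congr (lambda _); apply/seteqP; split => x; rewrite /ysection /= !inE.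
Qed.

Definition cross u v : R := u.1 * v.2 - u.2 * v.1.

(* A unimodular linear map is a product of at most four shears. *)
Lemma measure_unimodular u v (A : set plane) : cross u v = 1 -> measurable A ->
  mu [set z | A (dot z u, dot z v)] = mu A.
Proof.
have gen u' v' B : cross u' v' = 1 -> v'.1 != 0 -> measurable B ->
    mu [set z | B (dot z u', dot z v')] = mu B.
  move: u' v' => [a b] [c d]; rewrite /cross /= => abcd c0 mB.
  (* As [c] is nonzero, the map factors into three shears with parameters [x], [c], [y]. *)
  have [x aE] : exists x, a = x * c + 1 by exists ((a - 1) / c); rewrite divfK ?subrK.
  have [y dE] : exists y, d = y * c + 1 by exists ((d - 1) / c); rewrite divfK ?subrK.
  have bE : b = y + x * d.
    apply: (mulIf c0); have -> : b * c = a * d - 1 by rewrite -abcd; ring.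
    by rewrite aE dE; ring.
  have mB1 : measurable ([set z | B (z.1 + x * z.2, z.2)] : set plane).
    apply: (@measurable_linear_preimage (1, x) (0, 1) (fun z => (_, _))) mB.
    by move=> z; rewrite /dot /=; congr (_, _); ring.
  have mB2 : measurable ([set z | B (z.1 + x * (z.2 + c * z.1), z.2 + c * z.1)] : set plane).
    apply: (@measurable_linear_preimage (1, 0) (c, 1)
      (fun z => (z.1, z.2 + c * z.1))) mB1.
    by move=> z; rewrite /dot /=; congr (_, _); ring.
  rewrite -(shear_fst x mB) -(shear_snd c mB1) -(shear_fst y mB2).
  congr (mu _); apply: funext => -[z1 z2] /=; rewrite /dot /=; congr (B (_, _)).
  - by rewrite bE dE aE; ring.
  - by rewrite dE; ring.
move=> uv mA; have [v0|] := eqVneq v.1 0; last by move=> ?; exact: gen.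
have u0 : u.1 != 0.
  by apply/eqP => u0; move: uv; rewrite /cross u0 v0 mul0r mulr0 subr0 => /esym/eqP;
     rewrite oner_eq0.
have mB : measurable ([set z | A (z.1, z.2 + - 1 * z.1)] : set plane).
  apply: (@measurable_linear_preimage (1, 0) (- 1, 1)
    (fun z => (z.1, z.2 + - 1 * z.1))) mA.
  by move=> z; rewrite /dot /=; congr (_, _); ring.
rewrite -(shear_snd (- 1) mA) -(gen u (u + v) _ _ _ mB).
- by congr (mu _); apply: funext => z /=; rewrite dotDr; congr (A (_, _)); ring.
- by rewrite -uv /cross /=; ring.
- by rewrite /= v0 addr0.
Qed.

Lemma measure_standard_triangle (a b c : R) : 0 <= a + b - c ->
  mu [set z : R * R | [/\ z.1 <= a, z.2 <= b & c < z.1 + z.2]] =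
  ((a + b - c) ^+ 2 / 2)%:E.
Proof.
set T := [set z | _]; rewrite le_eqVlt => /predU1P[d0|d0].
  rewrite -d0 expr0n mul0r (_ : T = set0) ?measure0//.
  by apply/seteqP; split => // -[x y] [/= xa yb cxy]; lra.
have cba : c - b < a by lra.
transitivity (\int[lambda]_(x in `[(c - b)%R, a]) (x - (c - b))%R%:E)%E.
  rewrite [RHS]integral_mkcond; apply: eq_integral => x _ /=.
  rewrite patchE; case: ifPn => [|].
    rewrite inE /= in_itv /= => /andP[x1 x2].
    have -> : xsection T x = `]c - x, b]%classic.
      apply/seteqP; split => y; rewrite /xsection /= inE in_itv /=.
        by case=> _ h1 h2; rewrite h1 andbT ltrBlDl.
      by rewrite ltrBlDl => /andP[? ?]; split.
    rewrite lebesgue_measure_itv /= lte_fin -EFinD.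
    case: ltP => h; first by congr (_%:E); ring.
    by congr (_%:E); lra.
  rewrite notin_setE /= in_itv /= => /negP xn.
  have -> : xsection T x = set0; last by rewrite measure0.
  apply/seteqP; split => // y; rewrite /xsection /= inE => -[/= h1 h2 h3].
  by move: xn; rewrite h1 andbT -ltNge; lra.
pose F (x : R) := (x - (c - b)) ^+ 2 / 2.
have dF (x : R) : is_derive x 1 F (x - (c - b)).
  by apply: is_derive_eq; rewrite /GRing.scale /=; field.
transitivity ((F a)%:E - (F (c - b)%R)%:E)%E; last first.
  rewrite /F subrr expr0n mul0r sube0; congr (_%:E); congr (_ ^+ 2 / 2); ring.
apply: continuous_FTC2 => //.
- by apply: continuous_subspaceT => x; by apply: cvgB; [exact: cvg_id|exact: cvg_cst].
- have cF : continuous F by move=> x; apply/differentiable_continuous/derivable1_diffP.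
  by split => //; [apply: cvg_at_right_filter; exact: cF|apply: cvg_at_left_filter; exact: cF].
- by move=> x _; rewrite derive1E; exact: derive_val.
Qed.

Implicit Types (z : R * R) (h : R * R -> R).

(** * Decomposition of the bounding box into a polygon and its corners *)

Definition halfplane h u : set (R * R) := [set z | dot z u <= h u].

Fixpoint tree_polygon n h u v : set (R * R) :=
  if n is n'.+1 then halfplane h (u + v) `&` tree_polygon n' h u (u + v) `&`
    tree_polygon n' h (u + v) v
  else setT.

Definition corner n h u v := halfplane h u `&` halfplane h v `\` tree_polygon n h u v.

Lemma measurable_tree_polygon n h u v : measurable (tree_polygon n h u v : set plane).
Proof.
elim: n u v => [|n IH] u v /=; first exact: measurableT.
by do 2?[apply: measurableI => //]; exact: measurable_halfplane.
Qed.

Lemma measurable_corner n h u v : measurable (corner n h u v : set plane).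
Proof.
apply: measurableD; last exact: measurable_tree_polygon.
by apply: measurableI; exact: measurable_halfplane.
Qed.

Lemma tree_polygonP n h u v z : ~ tree_polygon n h u v z ->
  exists a b : R, [/\ 0 <= a, 0 <= b & h (a *: u + b *: v) < dot z (a *: u + b *: v)].
Proof.
elim: n u v => [|n IH] u v /=; first by move=> /(_ I).
have [h1|/negP h1] := boolP (dot z (u + v) <= h (u + v)); last first.
  by move=> _; exists 1, 1; rewrite !scale1r ltNge; split => //; apply/negP.
move=> /not_andP[/not_andP[//|/IH]|/IH] [a [b [a0 b0]]] H.
- exists (a + b), b; split => //; first exact: addr_ge0.
  by rewrite scalerDl -addrA -scalerDr.
- exists a, (a + b); split => //; first exact: addr_ge0.
  by rewrite scalerDl addrA -scalerDr.
Qed.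

Lemma cornerP n h u v z : sublinear h -> corner n h u v z ->
  [/\ dot z u <= h u, dot z v <= h v & exists a b : R,
  [/\ 0 < a, 0 < b & h (a *: u + b *: v) < dot z (a *: u + b *: v)]].
Proof.
move=> [_ hh] [[zu zv] /tree_polygonP[a [b [a0 b0 H]]]]; split => //.
exists a, b; split => //.
- rewrite lt_neqAle a0 andbT; apply/eqP => a_0.
  by move: H; rewrite -a_0 scale0r add0r hh// dotZr ltNge ler_wpM2l.
- rewrite lt_neqAle b0 andbT; apply/eqP => b_0.
  by move: H; rewrite -b_0 scale0r addr0 hh// dotZr ltNge ler_wpM2l.
Qed.

Lemma violated_sum h u v z (c d : R) : sublinear h -> 0 < c -> 0 < d ->
  h u < dot z u -> h v < dot z v -> h (c *: u + d *: v) < dot z (c *: u + d *: v).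
Proof.
move=> [sh hh] c0 d0 hu hv; apply: le_lt_trans (sh _ _) _.
by rewrite !hh ?ltW// dotDr !dotZr ltrD// ltr_pM2l.
Qed.

(** Here [s] is 1 for the two children of a node and 0 for adjacent quadrants, where [v = - u]. A
    common point violates the bounds at some [a *: u + b *: w] and [c *: w + d *: v]; adding them
    with weights [d] and [a] leaves, by [u + v = s *: w], a violated multiple of [w]. *)
Lemma corner_disjoint m n h u w v (s : R) : sublinear h -> 0 <= s ->
  u + v = s *: w -> [disjoint corner m h u w & corner n h w v].
Proof.
move=> sh s0 uv; apply/disj_setPS => z [].
move=> /(cornerP sh)[zu zw [a [b [a0 b0 H1]]]].
move=> /(cornerP sh)[_ zv [c [d [c0 d0 H2]]]].
have := violated_sum sh d0 a0 H1 H2.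
have -> : d *: (a *: u + b *: w) + a *: (c *: w + d *: v) =
    (a * d * s + (d * b + a * c)) *: w.
  rewrite !scalerDr !scalerA [d * a]mulrC addrACA [X in _ + X]addrC addrACA.
  rewrite -scalerDr uv !scalerDl addrA [d * b *: w + _]addrC addrA.
  rewrite addrAC [LHS]addrAC [in RHS]addrAC.
  by rewrite scalerA addrAC.
have [_ hh] := sh.
have k0 : 0 <= a * d * s + (d * b + a * c).
  by rewrite addr_ge0 ?addr_ge0 ?mulr_ge0// ?mulr_ge0// ltW.
by rewrite hh// dotZr ltNge ler_wpM2l.
Qed.

(** The combination now leaves a multiple of [v] of unknown sign, but the point satisfies the bounds
    at both [v] and [- v]. *)
Lemma corner_disjoint_opp m n h u v : sublinear h ->
  [disjoint corner m h u v & corner n h (- u) (- v)].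
Proof.
move=> sh; apply/disj_setPS => z [].
move=> /(cornerP sh)[zu zv [a [b [a0 b0 H1]]]].
move=> /(cornerP sh)[_ zNv [c [d [c0 d0 H2]]]].
have := violated_sum sh c0 a0 H1 H2.
have -> : c *: (a *: u + b *: v) + a *: (c *: - u + d *: - v) =
    (c * b - a * d) *: v.
  rewrite !scalerDr !scalerA !scalerN [c * a]mulrC addrACA subrr add0r scalerBl.
  by [].
have [_ hh] := sh.
have [k0|k0] := leP 0 (c * b - a * d).
  by rewrite hh// dotZr ltNge ler_wpM2l.
have -> : (c * b - a * d) *: v = (a * d - c * b) *: (- v).
  by rewrite scalerN -scaleNr opprB.
have k1 : 0 <= a * d - c * b by rewrite -oppr_le0 opprB ltW.
by rewrite hh// dotZr ltNge ler_wpM2l.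
Qed.

(** By the same elimination, a violation at [v] would produce one at a multiple of [w]. For [s = 1]
    this places the corners of the children inside that of their parent, for [s = 0] those of the
    quadrants inside the box. *)
Lemma corner_subl n h u w v (s : R) : sublinear h -> 0 <= s -> u + v = s *: w ->
  corner n h u w `<=` halfplane h v.
Proof.
move=> sh s0 uv z /(cornerP sh)[zu zw [a [b [a0 b0 H]]]].
rewrite /halfplane /= leNgt; apply/negP => K; have [_ hh] := sh.
have := violated_sum sh (@ltr01 R) a0 H K.
rewrite scale1r addrAC -scalerDr uv scalerA -scalerDl.
have k0 : 0 <= a * s + b by rewrite addr_ge0 ?mulr_ge0// ltW.
by rewrite hh// dotZr ltNge ler_wpM2l.
Qed.

Lemma corner_subr n h u w v (s : R) : sublinear h -> 0 <= s -> u + v = s *: w ->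
  corner n h w v `<=` halfplane h u.
Proof.
move=> sh s0 uv z /(cornerP sh)[zw zv [a [b [a0 b0 H]]]].
rewrite /halfplane /= leNgt; apply/negP => K; have [_ hh] := sh.
have := violated_sum sh (@ltr01 R) b0 H K.
rewrite scale1r -addrA -scalerDr [v + u]addrC uv scalerA -scalerDl.
have k0 : 0 <= a + b * s by rewrite addr_ge0 ?mulr_ge0// ltW.
by rewrite hh// dotZr ltNge ler_wpM2l.
Qed.

Definition cut_triangle h u v : set (R * R) :=
  halfplane h u `&` halfplane h v `\` halfplane h (u + v).

Lemma measurable_cut_triangle h u v : measurable (cut_triangle h u v : set plane).
Proof.
apply: measurableD; last exact: measurable_halfplane.
by apply: measurableI; exact: measurable_halfplane.
Qed.

Lemma measure_cut_triangle h u v : cross u v = 1 -> 0 <= gap h u v ->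
  mu (cut_triangle h u v) = (gap h u v ^+ 2 / 2)%:E.
Proof.
move=> uv g0; rewrite -(measure_standard_triangle g0).
have mT : measurable ([set z | [/\ z.1 <= h u, z.2 <= h v & h (u + v) < z.1 + z.2]] : set plane).
  have e10 z : dot z (1, 0) = z.1 by rewrite /dot /= mulr1 mulr0 addr0.
  have e01 z : dot z (0, 1) = z.2 by rewrite /dot /= mulr1 mulr0 add0r.
  have e11 z : dot z (1, 1) = z.1 + z.2 by rewrite /dot /= !mulr1.
  rewrite (_ : [set z | _] = [set z | dot z (1, 0) <= h u] `&`
    [set z | dot z (0, 1) <= h v] `&` ~` [set z | dot z (1, 1) <= h (u + v)]).
    apply: measurableI; last by apply: measurableC; exact: measurable_halfplane.
    by apply: measurableI; exact: measurable_halfplane.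
  apply: funext => z; rewrite /= e10 e01 e11 propeqE; split.
    by move=> [? ? ?]; split => //; apply/negP; rewrite -ltNge.
  by move=> [[? ?] /negP]; rewrite -ltNge.
rewrite -(measure_unimodular uv mT); congr (mu _); apply: funext => z /=.
rewrite /cut_triangle /halfplane /= dotDr propeqE; split.
  by move=> [[? ?] /negP]; rewrite -ltNge.
by move=> [? ? ?]; split => //; apply/negP; rewrite -ltNge.
Qed.

Lemma cornerS n h u v : sublinear h -> corner n.+1 h u v =
  cut_triangle h u v `|` (corner n h u (u + v) `|` corner n h (u + v) v).
Proof.
move=> sh; have uv : u + v = 1 *: (u + v) by rewrite scale1r.
apply/seteqP; split => z.
  move=> [[zu zv] /= H].
  have [zw|zw] := pselect (halfplane h (u + v) z); last by left.
  right; have /not_andP[] :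
      ~ (tree_polygon n h u (u + v) z /\ tree_polygon n h (u + v) v z).
    by move=> [? ?]; exact: H.
  - by left.
  - by right.
case=> [[[zu zv] zw]|[C|C]].
- by split => // -[[]].
- have zv := corner_subl sh ler01 uv C; case: C => -[zu zw] H.
  by split => // -[[]].
- have zu := corner_subr sh ler01 uv C; case: C => -[zw zv] H.
  by split => // -[[]].
Qed.

Lemma cross_addr u v : cross u (u + v) = cross u v.
Proof. by rewrite /cross /=; ring. Qed.

Lemma cross_addl u v : cross (u + v) v = cross u v.
Proof. by rewrite /cross /=; ring. Qed.

Lemma measure_corner n h u v : sublinear h -> cross u v = 1 ->
  mu (corner n h u v) = (gapsum n h h u v / 2)%:E.
Proof.
move=> sh; elim: n u v => [|n IH] u v uv.
  by rewrite /corner /= setDT measure0 mul0r.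
have mC := @measurable_corner n h.
rewrite cornerS// measureU; [|exact: measurable_cut_triangle|exact: measurableU|].
  rewrite measureU//; last first.
    by apply/eqP; apply: (@corner_disjoint _ _ _ _ _ _ 1);
      rewrite ?scale1r ?ler01.
  rewrite /= !IH ?cross_addr ?cross_addl// measure_cut_triangle// ?gap_ge0//.
  by rewrite -!EFinD /=; congr (_%:E); ring.
by apply/seteqP; split => // z [[_ zw] [|] [[z1 z2] _]]; apply: zw.
Qed.

Definition polygon n h : set (R * R) :=
  (halfplane h e1 `&` halfplane h (- e1) `&` (halfplane h e2 `&` halfplane h (- e2))) `&`
  (tree_polygon n h e1 e2 `&` tree_polygon n h e2 (- e1) `&`
   (tree_polygon n h (- e1) (- e2) `&` tree_polygon n h (- e2) e1)).

Definition box h := halfplane h e1 `&` halfplane h (- e1) `&`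
  (halfplane h e2 `&` halfplane h (- e2)).

Lemma measurable_polygon n h : measurable (polygon n h : set plane).
Proof.
have mt := @measurable_tree_polygon n h; have mh := measurable_halfplane.
by repeat first [exact: mh | exact: mt | apply: measurableI].
Qed.

Lemma measure_box h : 0 <= h e1 + h (- e1) -> 0 <= h e2 + h (- e2) ->
  mu (box h) = ((h e1 + h (- e1)) * (h e2 + h (- e2)))%:E.
Proof.
move=> w1 w2.
have -> : box h = (`[- h (- e1), h e1]%classic `*` `[- h (- e2), h e2]%classic).
  apply: funext => -[x y]; rewrite /box /halfplane /= !dotNr /dot /e1 /e2 /= !in_itv /=.
  rewrite !(mulr1, mulr0, addr0, add0r) propeqE lerNl; split.
    by move=> [[-> ->] [-> H]]; split => //; rewrite lerNl H.
  by move=> [/andP[-> ->] /andP[H ->]]; rewrite lerNl in H.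
rewrite product_measure1E//= !lebesgue_measure_itv /= !lte_fin.
have side (a b : R) : 0 <= a + b ->
    (if - b < a then (a%:E - (- b)%:E)%E else 0%E) = (a + b)%:E.
  by move=> ab; case: ltP => ?; [rewrite -EFinB opprK|congr (_%:E); lra].
by rewrite !side.
Qed.

Lemma measure_polygon n h : sublinear h ->
  mu (polygon n h) = ((h e1 + h (- e1)) * (h e2 + h (- e2)) -
   (gapsum n h h e1 e2 + gapsum n h h e2 (- e1) + gapsum n h h (- e1) (- e2) +
    gapsum n h h (- e2) e1) / 2)%:E.
Proof.
move=> sh; have h0 : h 0 = 0 by have [_ hh] := sh; rewrite -(scale0r 0) hh// mul0r.
have w1 : 0 <= h e1 + h (- e1) by have [sh' _] := sh; have := sh' e1 (- e1); rewrite subrr h0.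
have w2 : 0 <= h e2 + h (- e2) by have [sh' _] := sh; have := sh' e2 (- e2); rewrite subrr h0.
have c1 : cross e1 e2 = 1 :> R by rewrite /cross /=; ring.
have c2 : cross e2 (- e1) = 1 :> R by rewrite /cross /=; ring.
have c3 : cross (- e1) (- e2) = 1 :> R by rewrite /cross /=; ring.
have c4 : cross (- e2) e1 = 1 :> R by rewrite /cross /=; ring.
pose C1 := corner n h e1 e2; pose C2 := corner n h e2 (- e1).
pose C3 := corner n h (- e1) (- e2); pose C4 := corner n h (- e2) e1.
have mC := @measurable_corner n h.
have z0 u w : u - u = 0 *: w :> R * R by rewrite subrr scale0r.
have z0' u w : - u + u = 0 *: w :> R * R by rewrite addNr scale0r.
have D u w v : u + v = 0 *: w -> corner n h u w `&` corner n h w v = set0.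
  by move=> uv; apply/eqP; exact: corner_disjoint sh (lexx 0) uv.
have D13 : C1 `&` C3 = set0.
  by apply/eqP; exact: corner_disjoint_opp.
have D24 : C2 `&` C4 = set0.
  apply/eqP; rewrite /C4 -[X in corner n h _ X]opprK.
  exact: corner_disjoint_opp.
have boxE : box h = polygon n h `|` (C1 `|` C2 `|` (C3 `|` C4)).
  apply/seteqP; split => z.
    move=> B; have [] := B => -[z1 z2] [z3 z4].
    have [t1|t1] := pselect (tree_polygon n h e1 e2 z); last by right; left; left.
    have [t2|t2] := pselect (tree_polygon n h e2 (- e1) z); last by right; left; right.
    have [t3|t3] := pselect (tree_polygon n h (- e1) (- e2) z); last by right; right; left.
    have [t4|t4] := pselect (tree_polygon n h (- e2) e1 z); last by right; right; right.
    by left.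
  case; first by case.
  have S u w : corner n h u w `<=` halfplane h u `&` halfplane h w `&`
      (halfplane h (- u) `&` halfplane h (- w)).
    move=> y C; have yu := corner_subl sh (lexx 0) (z0 u w) C.
    have yw := corner_subr sh (lexx 0) (z0' w u) C.
    by case: C => -[? ?] _.
  case=> [[]|[]] /S [[? ?] []]; rewrite ?opprK => ? ?; by split; split.
have : mu (box h) = (mu (polygon n h) + (mu C1 + mu C2 + (mu C3 + mu C4)))%E.
  have mP := @measurable_polygon n h.
  rewrite boxE measureU => [|//||]; last 2 first.
  - by do 2?apply: measurableU => //; exact: mC.
  - apply/seteqP; split => // z [[_ [[t1 t2] [t3 t4]]]].
    by case=> [[]|[]] [_].
  congr (_ + _)%E.
  rewrite measureU => [||//|]; last 3 first.
  - by apply: measurableU; exact: mC.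
  - by apply: measurableU; exact: mC.
  - rewrite setIUl !setIUr D13 D24 D ?z0//.
    rewrite setIC D ?z0'// !setU0//.
  by congr (_ + _)%E; rewrite measureU ?D//; exact: mC.
rewrite measure_box// !measure_corner// -!EFinD => H.
(* The box has finite area, so [H] can be solved for the area of the polygon in [R]. *)
have fP : mu (polygon n h) \is a fin_num.
  by move: H; case: (mu (polygon n h)).
move: H; rewrite -(fineK fP) -EFinD => -[H].
by congr (_%:E); lra.
Qed.

End PlaneMeasure.

(** * Mixed areas of convex bodies *)

Section ConvexBodies.
Context {R : realType}.
Implicit Types (u v w x y z : R * R) (h : R * R -> R) (K L : set (R * R)).

Notation lambda := (@lebesgue_measure R).
Notation mu := (lambda \x lambda)%E.
Notation plane := (measurableTypeR R * measurableTypeR R)%type.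

Lemma continuous_pair (f g : R * R -> R) : continuous f -> continuous g ->
  continuous ((fun z => (f z, g z)) : R * R -> R * R).
Proof.
move=> cf cg z; apply: (@cvg_pair _ _ _ (nbhs z) (nbhs (f z)) (nbhs (g z))).
- exact: cf.
- exact: cg.
Qed.

Lemma continuous_fst : continuous (fun z : R * R => z.1).
Proof. by case=> a b; apply: (@cvg_fst _ _ (nbhs a) (nbhs b)). Qed.

Lemma continuous_snd : continuous (fun z : R * R => z.2).
Proof. by case=> a b; apply: (@cvg_snd _ _ (nbhs a) (nbhs b)). Qed.

Lemma continuous_dot u : continuous (fun z : R * R => dot z u).
Proof.
move=> z; apply: cvgD; apply: cvgM; try exact: cvg_cst.
- exact: continuous_fst.
- exact: continuous_snd.
Qed.

(** A choice of touching point; for convex bodies it exists by compactness, and the default 0 is not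
    reached. *)
Definition contact K u : R * R :=
  xget 0 [set y | K y /\ forall z, K z -> dot z u <= dot y u].

Lemma contactP K u : convex_body2 K ->
  K (contact K u) /\ forall z, K z -> dot z u <= dot (contact K u) u.
Proof.
move=> [K0 [cK _]].
have [|y yK ymax] := compact_EVT_max (f := fun z => dot z u) K0 cK.
  by apply: continuous_subspaceT; exact: continuous_dot.
rewrite /contact; apply: (@xgetPex _ 0 [set y | K y /\ forall z, K z -> dot z u <= dot y u]).
exists y; split; first by rewrite inE in yK.
by move=> z zK; apply: ymax; rewrite inE.
Qed.

Lemma contact_tight K : convex_body2 K -> tight (contact K).
Proof.
move=> bK u w; have [_] := contactP u bK; apply.
by have [] := contactP w bK.
Qed.

Notation hK K := (supp (contact K)).

Lemma le_supp K u z : convex_body2 K -> K z -> dot z u <= hK K u.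
Proof. by move=> bK; have [_] := contactP u bK; apply. Qed.

Lemma supp_unique K u y : convex_body2 K -> K y ->
  (forall z, K z -> dot z u <= dot y u) -> hK K u = dot y u.
Proof.
move=> bK Ky H; apply/eqP; rewrite eq_le le_supp// andbT.
by apply: H; have [] := contactP u bK.
Qed.

(** The subtractive Euclidean algorithm again: up to a factor, every integer direction between [u]
    and [v] is a node of the tree. *)
Lemma tree_polygon_nat (a b : nat) h u v z : sublinear h ->
  dot z u <= h u -> dot z v <= h v -> (forall n, tree_polygon n h u v z) ->
  dot z (a%:R *: u + b%:R *: v) <= h (a%:R *: u + b%:R *: v).
Proof.
move=> [sh hh]; have [k] := ubnP (a + b)%N.
elim: k a b u v => // k IH a b u v abk zu zv zt.
have [->|a0] := posnP a; first by rewrite scale0r add0r hh// dotZr ler_wpM2l.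
have [->|b0] := posnP b; first by rewrite scale0r addr0 hh// dotZr ler_wpM2l.
have zw : dot z (u + v) <= h (u + v) by have [[]] := zt 1%N.
have [ab|ba] := leqP a b.
- have -> : a%:R *: u + b%:R *: v = a%:R *: (u + v) + (b - a)%:R *: v.
    by rewrite scalerDr -addrA -scalerDl -natrD subnKC.
  apply: IH => //; last by move=> n; have [[]] := zt n.+1.
  by rewrite subnKC// -ltnS (leq_trans _ abk)// ltnS -[X in (X < _)%N]add0n ltn_add2r.
- have -> : a%:R *: u + b%:R *: v = (a - b)%:R *: u + b%:R *: (u + v).
    rewrite scalerDr addrA -scalerDl -natrD subnK//; exact: ltnW.
  apply: IH => //; last by move=> n; have [[]] := zt n.+1.
  rewrite subnK; last exact: ltnW.
  by rewrite -ltnS (leq_trans _ abk)// ltnS -[X in (X < _)%N]addn0 ltn_add2l.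
Qed.

Lemma tree_polygon_real (a b : R) h u v z : sublinear h -> 0 <= a -> 0 <= b ->
  dot z u <= h u -> dot z v <= h v -> (forall n, tree_polygon n h u v z) ->
  dot z (a *: u + b *: v) <= h (a *: u + b *: v).
Proof.
move=> sh a0 b0 zu zv zt.
apply: (@ler_addinvn _ _ _ ((h u - dot z u) + (h v - dot z v))) => n.
have [i [_ ai ia]] := nat_upper_approx n a0.
have [j [_ bj jb]] := nat_upper_approx n b0.
set N := n.+1%:R^-1 in ai ia bj jb *; have N0 : 0 <= N by rewrite invr_ge0.
have H := tree_polygon_nat i j sh zu zv zt.
have [s_ hh] := sh.
have {H} : dot z ((N * i%:R) *: u + (N * j%:R) *: v) <= h ((N * i%:R) *: u + (N * j%:R) *: v).
  by rewrite -!scalerA -scalerDr dotZr hh// ler_wpM2l.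
set s := N * i%:R in ai ia *; set t := N * j%:R in bj jb *.
have := s_ (a *: u + b *: v) ((s - a) *: u + (t - b) *: v).
have := s_ ((s - a) *: u) ((t - b) *: v).
have -> : a *: u + b *: v + ((s - a) *: u + (t - b) *: v) = s *: u + t *: v.
  by rewrite !scalerBl addrACA [a *: u + _]addrC [b *: v + _]addrC !subrK.
rewrite !hh ?subr_ge0// !dotDr !dotZr => H1 H2 H3.
have H4 : (s - a) * (h u - dot z u) <= N * (h u - dot z u).
  by rewrite ler_wpM2r ?subr_ge0//; lra.
have H5 : (t - b) * (h v - dot z v) <= N * (h v - dot z v).
  by rewrite ler_wpM2r ?subr_ge0//; lra.
rewrite -/N; lra.
Qed.

Lemma bigcap_polygon h z : sublinear h -> (forall n, polygon n h z) ->
  forall w, dot z w <= h w.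
Proof.
move=> sh H w.
have [[z1 z2] [z3 z4]] : box h z by case: (H 0%N).
have t1 n : tree_polygon n h e1 e2 z by have [_ [[]]] := H n.
have t2 n : tree_polygon n h e2 (- e1) z by have [_ [[]]] := H n.
have t3 n : tree_polygon n h (- e1) (- e2) z by have [_ [_ []]] := H n.
have t4 n : tree_polygon n h (- e2) e1 z by have [_ [_ []]] := H n.
have E (a b : R) : w = (a, b) -> w = a *: e1 + b *: e2.
  move=> ->; rewrite [RHS]surjective_pairing; congr (_, _);
    by rewrite /= /GRing.scale /=; ring.
have {E} wE := E _ _ (surjective_pairing w).
have flip (a : R) u : a *: u = (- a) *: (- u) by rewrite scaleNr scalerN opprK.
have [w1|/ltW w1] := leP 0 w.1; have [w2|/ltW w2] := leP 0 w.2; rewrite wE.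
- exact: tree_polygon_real.
- by rewrite addrC [w.2 *: _]flip tree_polygon_real ?oppr_ge0.
- by rewrite addrC [w.1 *: _]flip tree_polygon_real ?oppr_ge0.
- by rewrite [w.1 *: _]flip [w.2 *: _]flip tree_polygon_real ?oppr_ge0.
Qed.

Lemma separation K z : convex_body2 K -> (forall w, dot z w <= hK K w) -> K z.
Proof.
move=> bK H; have [K0 [cK vK]] := bK.
(* The squared distance of [y] and [z], up to a constant: [q] will be the point of [K] nearest to
   [z], and [K] will be supported at [q] in direction [z - q]. *)
pose f y := dot y (- 2 *: z) + dot y y.
have cf : continuous f.
  move=> y; apply: cvgD; first exact: continuous_dot.
  by apply: cvgD; apply: cvgM; first [exact: continuous_fst|exact: continuous_snd].
have [|q] := compact_EVT_min (f := f) K0 cK; first exact: continuous_subspaceT.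
rewrite inE => qK qmin.
pose w := z - q.
have sep y : K y -> dot y w <= dot q w.
  move=> yK; rewrite -subr_le0.
  have step (t : R) : 0 < t -> t <= 1 ->
      0 <= t * (- 2 * (dot y w - dot q w) + t * dot (y - q) (y - q)).
    move=> t0 t1; have := vK _ _ yK qK t (ltW t0) t1.
    set m := (_, _) => mK; have := qmin m; rewrite inE => /(_ mK).
    rewrite -subr_ge0; congr (0 <= _).
    by rewrite /f /w /m /dot /= /GRing.scale /=; ring.
  rewrite leNgt; apply/negP; set d := dot y w - dot q w => d0.
  have D0 : 0 <= dot (y - q) (y - q) by rewrite /dot -!expr2 addr_ge0 ?sqr_ge0.
  set D := dot (y - q) (y - q) in step D0.
  have Dd : 0 < D + d by lra.
  (* Small enough for the quadratic term: [t * D <= d], so that [- 2 * d + t * D] is negative. *)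
  pose t := d / (D + d).
  have t0 : 0 < t by rewrite divr_gt0.
  have t1 : t <= 1 by rewrite ler_pdivrMr// mul1r; lra.
  have tD : t * D <= d by rewrite mulrAC ler_pdivrMr// ler_wpM2l//; lra.
  have := step _ t0 t1; rewrite pmulr_rge0// leNgt => /negP; apply.
  move: tD; rewrite -/d; move: (t * D) => s; lra.
have hw : hK K w = dot q w by exact: supp_unique.
have := H w; rewrite hw -subr_le0 => ww.
have {}ww : dot w w <= 0 by move: ww; rewrite /w /dot /=; lra.
have w1 : w.1 ^+ 2 = 0.
  by apply/eqP; rewrite eq_le sqr_ge0 andbT; move: ww; rewrite /dot -!expr2;
    have := sqr_ge0 w.2; lra.
have w2 : w.2 ^+ 2 = 0.
  by apply/eqP; rewrite eq_le sqr_ge0 andbT; move: ww; rewrite /dot -!expr2;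
    have := sqr_ge0 w.1; lra.
suff -> : z = q by [].
apply/eqP; rewrite -subr_eq0 -/w [w]surjective_pairing.
move/eqP: w1; move/eqP: w2; rewrite !sqrf_eq0 => /eqP -> /eqP ->.
by [].
Qed.

Lemma bigcap_polygonE K : convex_body2 K -> \bigcap_n polygon n (hK K) = K.
Proof.
move=> bK; have sK := supp_sublinear (contact_tight bK).
apply/seteqP; split => z.
  by move=> H; apply: separation => // w; apply: bigcap_polygon => // n; exact: H.
move=> Kz n _; have Hz u : halfplane (hK K) u z by exact: le_supp.
have Tz u v : tree_polygon n (hK K) u v z.
  elim: n u v => [//|n IH] u v; split; last exact: IH.
  by split; [exact: Hz|exact: IH].
by split; split; split.
Qed.

Lemma tree_polygonS n h u v : tree_polygon n.+1 h u v `<=` tree_polygon n h u v.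
Proof.
elim: n u v => [//|n IH] u v z [[zw zl] zr]; split; first split => //.
  exact: IH.
exact: IH.
Qed.

Lemma measurable_convex_body K : convex_body2 K -> measurable (K : set plane).
Proof.
move=> bK; rewrite -(bigcap_polygonE bK); apply: bigcapT_measurable => n.
exact: measurable_polygon.
Qed.

Lemma cvg_area K : convex_body2 K ->
  (fun n => mixed_approx n (contact K) (hK K) / 2) @ \oo --> area K.
Proof.
move=> bK; have sK := supp_sublinear (contact_tight bK).
have E n : mu (polygon n (hK K)) = (mixed_approx n (contact K) (hK K) / 2)%:E.
  by rewrite measure_polygon// mixed_approxE; congr (_%:E); field.
have cv : mu \o (fun n => polygon n (hK K)) @ \oo --> mu K.
  rewrite -[X in _ --> mu X](bigcap_polygonE bK); apply: nonincreasing_cvg_mu.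
  - by rewrite /= E ltry.
  - by move=> n; exact: measurable_polygon.
  - by apply: bigcapT_measurable => n; exact: measurable_polygon.
  - apply/nonincreasing_seqP => n; apply/subsetPset => z [zb [[z1 z2] [z3 z4]]].
    by split => //; split; split; exact: tree_polygonS.
have fin : mu K \is a fin_num.
  rewrite ge0_fin_numE//; apply: (@le_lt_trans _ _ (mu (polygon 0 (hK K)))).
    apply: le_measure; rewrite ?inE.
    - exact: measurable_convex_body.
    - exact: measurable_polygon.
    - by rewrite -{1}(bigcap_polygonE bK) => z; apply.
  by rewrite E ltry.
rewrite -(fineK fin) in cv; move/fine_cvg: cv.
by rewrite (_ : fine \o _ = fun n => mixed_approx n (contact K) (hK K) / 2)//;
  apply: funext => n /=; rewrite E.
Qed.

Implicit Types (M N : set (R * R)).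

(** * Mixed areas as limits of the expansion *)

Lemma convex_body2_sum K L : convex_body2 K -> convex_body2 L ->
  convex_body2 (minkowski_sum K L).
Proof.
move=> [[x Kx] [cK vK]] [[y Ly] [cL vL]]; split; [|split].
- by exists (x.1 + y.1, x.2 + y.2), x, y.
- have -> : minkowski_sum K L =
      (fun s : (R * R) * (R * R) => (s.1.1 + s.2.1, s.1.2 + s.2.2)) @` (K `*` L).
    apply/seteqP; split=> [_ [a [b [Ka [Lb ->]]]]|_ [[a b] [Ka Lb] <-]].
      by exists (a, b).
    by exists a, b.
  apply: continuous_compact; last exact: compact_setX.
  apply: continuous_subspaceT => -[a b].
  have c1 : continuous (fun s : (R * R) * (R * R) => s.1).
    by case=> c d; apply: (@cvg_fst _ _ (nbhs c) (nbhs d)).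
  have c2 : continuous (fun s : (R * R) * (R * R) => s.2).
    by case=> c d; apply: (@cvg_snd _ _ (nbhs c) (nbhs d)).
  have cc i j : continuous (fun s : (R * R) * (R * R) =>
      (if i then fst else snd) ((if j then fst else snd) s) : R).
    move=> s; apply: (@continuous_comp _ _ _ (if j then fst else snd) (if i then fst else snd)).
      by case: j; [exact: c1|exact: c2].
    by case: i; [exact: continuous_fst|exact: continuous_snd].
  apply: (@cvg_pair _ _ _ (nbhs (a, b)) (nbhs (a.1 + b.1)) (nbhs (a.2 + b.2))).
  + by apply: cvgD; [exact: (cc true true (a, b))|exact: (cc true false (a, b))].
  + by apply: cvgD; [exact: (cc false true (a, b))|exact: (cc false false (a, b))].
- move=> _ _ [a [b [Ka [Lb ->]]]] [c [d [Kc [Ld ->]]]] t t0 t1.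
  exists (t * a.1 + (1 - t) * c.1, t * a.2 + (1 - t) * c.2).
  exists (t * b.1 + (1 - t) * d.1, t * b.2 + (1 - t) * d.2).
  split; first exact: vK; split; first exact: vL.
  by congr (_, _) => /=; ring.
Qed.

Lemma supp_sum K L u : convex_body2 K -> convex_body2 L ->
  hK (minkowski_sum K L) u = hK K u + hK L u.
Proof.
move=> bK bL; have [Kp pmax] := contactP u bK; have [Lq qmax] := contactP u bL.
set p := contact K u in Kp pmax *; set q := contact L u in Lq qmax *.
rewrite (@supp_unique _ _ (p.1 + q.1, p.2 + q.2)).
- by rewrite /supp -/p -/q /dot /=; ring.
- exact: convex_body2_sum.
- by exists p, q.
- move=> _ [a [b [Ka [Lb ->]]]]; have := pmax _ Ka; have := qmax _ Lb.
  by rewrite /dot /=; lra.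
Qed.

Lemma eq_mixed_approx n (p p' : R * R -> R * R) (g g' : R * R -> R) :
  supp p =1 supp p' -> g =1 g' -> mixed_approx n p g = mixed_approx n p' g'.
Proof. by move=> /funext pp' /funext ->; rewrite !mixed_approxE pp'. Qed.

Lemma cvg_mixed_area K L : convex_body2 K -> convex_body2 L ->
  (fun n => mixed_approx n (contact K) (hK L)) @ \oo --> 2 * mixed_area K L.
Proof.
move=> bK bL; have bKL := convex_body2_sum bK bL.
pose A n M := mixed_approx n (contact M) (hK M) / 2.
have -> : (fun n => mixed_approx n (contact K) (hK L)) =
    (fun n => A n (minkowski_sum K L) - A n K - A n L).
  apply: funext => n; rewrite /A.
  set p := contact K; set q := contact L; set r := contact (minkowski_sum K L).
  have rE : supp r =1 (fun w => supp p w + supp q w).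
    by move=> w; exact: supp_sum.
  have E M : mixed_approx n (contact M) (supp r) =
      mixed_approx n (contact M) (supp p) + mixed_approx n (contact M) (supp q).
    by rewrite -mixed_approxD; exact: eq_mixed_approx.
  rewrite E ![mixed_approx n r _]mixed_approxC !E [mixed_approx n q (supp p)]mixed_approxC.
  by field.
have -> : 2 * mixed_area K L = area (minkowski_sum K L) - area K - area L.
  by rewrite /mixed_area; field.
by apply: cvgB; first apply: cvgB; exact: cvg_area.
Qed.

Lemma mixed_area_le_approx K L n : convex_body2 K -> convex_body2 L ->
  2 * mixed_area K L <= mixed_approx n (contact K) (hK L).
Proof.
move=> bK bL; have cv := cvg_mixed_area bK bL.
rewrite -(cvg_lim _ cv)//; apply: nonincreasing_cvgn_ge.
  by apply/nonincreasing_seqP => k; apply: mixed_approx_leS; exact: contact_tight.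
by apply/cvg_ex; exists (2 * mixed_area K L).
Qed.

Lemma mixed_area_ge K L (c : R) : convex_body2 K -> convex_body2 L ->
  (forall n, c <= mixed_approx n (contact K) (hK L)) -> c <= 2 * mixed_area K L.
Proof.
move=> bK bL H; have cv := cvg_mixed_area bK bL.
rewrite -(cvg_lim _ cv)//; apply: limr_ge; last by near=> n; exact: H.
by apply/cvg_ex; exists (2 * mixed_area K L).
Unshelve. all: by end_near.
Qed.

Lemma mixed_areaC K L : mixed_area K L = mixed_area L K.
Proof.
rewrite /mixed_area (_ : minkowski_sum K L = minkowski_sum L K).
  by congr (_ / _); ring.
by apply/seteqP; split=> _ [a [b [Ka [Lb ->]]]]; exists b, a; split => //; split => //;
  congr (_, _); rewrite addrC.
Qed.

Lemma mixed_area_ge0 K L : convex_body2 K -> convex_body2 L -> 0 <= mixed_area K L.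
Proof.
move=> bK bL; rewrite -(@pmulr_rge0 _ 2)//; apply: mixed_area_ge => // n.
have [tK tL] := (contact_tight bK, contact_tight bL).
apply: mixed_approx_ge0 => //; last exact: supp_triangle_ge0.
by have [] := supp_sublinear tL.
Qed.

(** * Invariance under unimodular maps *)

Definition linear_image u v K : set (R * R) :=
  [set (dot z u, dot z v) | z in K].

Lemma convex_body2_linear_image u v K : convex_body2 K -> convex_body2 (linear_image u v K).
Proof.
move=> [[x Kx] [cK vK]]; split; [|split].
- by exists (dot x u, dot x v), x.
- apply: continuous_compact => //; apply: continuous_subspaceT.
  by apply: continuous_pair; exact: continuous_dot.
- move=> _ _ [a Ka <-] [b Kb <-] t t0 t1.
  exists (t * a.1 + (1 - t) * b.1, t * a.2 + (1 - t) * b.2); first exact: vK.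
  by rewrite /dot /=; congr (_, _); ring.
Qed.

Lemma area_linear_image u v K : cross u v = 1 -> convex_body2 K ->
  area (linear_image u v K) = area K.
Proof.
move=> uv bK; rewrite /area; congr fine.
rewrite -(measure_unimodular uv (measurable_convex_body (convex_body2_linear_image u v bK))).
congr (mu _); apply/seteqP; split => z; last by exists z.
case=> y Ky [y1 y2]; suff -> : z = y by [].
(* The inverse map by Cramer's rule; it shows that [K] is the full preimage of its image. *)
have inv x : x = (v.2 * dot x u - u.2 * dot x v, u.1 * dot x v - v.1 * dot x u).
  rewrite [LHS]surjective_pairing -[x.1]mul1r -[x.2]mul1r -uv.
  by rewrite /cross /dot; congr (_, _); ring.
by rewrite (inv z) (inv y) y1 y2.
Qed.

Lemma mixed_area_linear_image u v K L : cross u v = 1 ->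
  convex_body2 K -> convex_body2 L ->
  mixed_area (linear_image u v K) (linear_image u v L) = mixed_area K L.
Proof.
move=> uv bK bL; rewrite /mixed_area.
have -> : minkowski_sum (linear_image u v K) (linear_image u v L) =
    linear_image u v (minkowski_sum K L).
  apply/seteqP; split.
    move=> _ [_ [_ [[a Ka <-] [[b Lb <-] ->]]]].
    exists (a.1 + b.1, a.2 + b.2); first by exists a, b.
    by rewrite /dot /=; congr (_, _); ring.
  move=> _ [_ [a [b [Ka [Lb ->]]]] <-].
  exists (dot a u, dot a v), (dot b u, dot b v); split; first by exists a.
  split; first by exists b.
  by rewrite /dot /=; congr (_, _); ring.
by rewrite !area_linear_image//; exact: convex_body2_sum.
Qed.

Lemma supp_linear_image u v K (a b : R) : convex_body2 K ->
  hK (linear_image u v K) (a, b) = hK K (a *: u + b *: v).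
Proof.
move=> bK; have [Kp pmax] := contactP (a *: u + b *: v) bK.
set p := contact K _ in Kp pmax.
have E z : dot (dot z u, dot z v) (a, b) = dot z (a *: u + b *: v).
  by rewrite dotDr !dotZr /dot /=; ring.
rewrite (@supp_unique _ _ (dot p u, dot p v)).
- by rewrite E.
- exact: convex_body2_linear_image.
- by exists p.
- by move=> _ [y Ky <-]; rewrite !E; exact: pmax.
Qed.

(** [fan_plucker] takes one bound per corner, whereas a mixed area bounds only the sum over the
    three corners; by monotonicity the suprema share the total. *)
Lemma sup_add3_le (f g h : nat -> R) (c : R) :
  (forall m n, (m <= n)%N -> f m <= f n) -> (forall m n, (m <= n)%N -> g m <= g n) ->
  (forall m n, (m <= n)%N -> h m <= h n) ->
  (forall n, f n + g n + h n <= c) ->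
  exists F G H, [/\ forall n, f n <= F, forall n, g n <= G, forall n, h n <= H &
    F + G + H <= c].
Proof.
move=> mf mg mh H.
have H3 i j k : f i + g j + h k <= c.
  apply: le_trans (H (maxn i (maxn j k))); rewrite !lerD//.
  - by apply: mf; rewrite leq_maxl.
  - by apply: mg; rewrite leq_max leq_maxl orbT.
  - by apply: mh; rewrite !leq_max leqnn !orbT.
have step (F : nat -> R) (d : R) : (forall n, F n <= d) ->
    exists s, (forall n, F n <= s) /\ (forall e, (forall n, F n <= e) -> s <= e).
  move=> Fd; exists (sup (range F)); split=> [n|e Fe].
    by apply: ub_le_sup; [exists d => _ [k _ <-]|exists n].
  by apply: ge_sup; [exists (F 0%N), 0%N|move=> _ [k _ <-]].
have [F [F1 F2]] : exists s, (forall n, f n <= s) /\ (forall e, (forall n, f n <= e) -> s <= e).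
  by apply: (step f (c - g 0%N - h 0%N)) => n; have := H3 n 0%N 0%N; lra.
have [G [G1 G2]] : exists s, (forall n, g n <= s) /\ (forall e, (forall n, g n <= e) -> s <= e).
  by apply: (step g (c - f 0%N - h 0%N)) => n; have := H3 0%N n 0%N; lra.
have [S [S1 S2]] : exists s, (forall n, h n <= s) /\ (forall e, (forall n, h n <= e) -> s <= e).
  by apply: (step h (c - f 0%N - g 0%N)) => n; have := H3 0%N 0%N n; lra.
exists F, G, S; split => //.
suff : F <= c - G - S by lra.
apply: F2 => i; suff : G <= c - f i - S by lra.
apply: G2 => j; suff : S <= c - f i - g j by lra.
apply: S2 => k; have := H3 i j k; lra.
Qed.

Definition fan_approx n (p q : R * R -> R * R) u v w :=
  fan_size p u v w * fan_size q u v w -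
  (gapsum n (supp p) (supp q) u v + gapsum n (supp p) (supp q) v w +
   gapsum n (supp p) (supp q) w u).

(** Since [e2 - (e1 + e2) = - e1] and [e1 - (e1 + e2) = - e2], one subdivision of the fan of three
    normals gives the four quadrants, with [- (e1 + e2)] as the first node between [- e1] and
    [- e2]. The depths in the quadrants are then [n.+1], [n], [n.+1], [n], whence the two bounds. *)
Lemma mixed_approx_fan n (p q : R * R -> R * R) : tight p -> tight q ->
  mixed_approx n.+1 p (supp q) <= fan_approx n.+1 p q e1 e2 (- (e1 + e2)) /\
  fan_approx n.+1 p q e1 e2 (- (e1 + e2)) <= mixed_approx n p (supp q).
Proof.
move=> tp tq; have sp := supp_sublinear tp; have sq := supp_sublinear tq.
have le u v := gapsum_leS n u v sp sq.
have E1 : e2 - (e1 + e2) = - e1 :> R * R by rewrite opprD addrC addrNK.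
have E2 : - (e1 + e2) + e1 = - e2 :> R * R by rewrite opprD addrAC addNr add0r.
have E3 : - e1 + (- e2) = - (e1 + e2) :> R * R by rewrite opprD.
pose mid := (supp p e2 + supp p (- e2)) * (supp q e1 + supp q (- e1)) +
  (supp p e1 + supp p (- e1)) * (supp q e2 + supp q (- e2)) -
  (gapsum n.+1 (supp p) (supp q) e1 e2 + gapsum n (supp p) (supp q) e2 (- e1) +
   gapsum n.+1 (supp p) (supp q) (- e1) (- e2) + gapsum n (supp p) (supp q) (- e2) e1).
have -> : fan_approx n.+1 p q e1 e2 (- (e1 + e2)) = mid.
  rewrite /fan_approx /mid /fan_size.
  have -> : gapsum n.+1 (supp p) (supp q) e2 (- (e1 + e2)) =
    gap (supp p) e2 (- (e1 + e2)) * gap (supp q) e2 (- (e1 + e2)) +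
    gapsum n (supp p) (supp q) e2 (- e1) +
    gapsum n (supp p) (supp q) (- e1) (- (e1 + e2)) by rewrite /= E1.
  have -> : gapsum n.+1 (supp p) (supp q) (- (e1 + e2)) e1 =
    gap (supp p) (- (e1 + e2)) e1 * gap (supp q) (- (e1 + e2)) e1 +
    gapsum n (supp p) (supp q) (- (e1 + e2)) (- e2) +
    gapsum n (supp p) (supp q) (- e2) e1 by rewrite /= E2.
  have -> : gapsum n.+1 (supp p) (supp q) (- e1) (- e2) =
    gap (supp p) (- e1) (- e2) * gap (supp q) (- e1) (- e2) +
    gapsum n (supp p) (supp q) (- e1) (- (e1 + e2)) +
    gapsum n (supp p) (supp q) (- (e1 + e2)) (- e2) by rewrite /= E3.
  rewrite /gap E1 E2 E3; ring.
rewrite !mixed_approxE /mid; split; rewrite lerD2l lerN2 !lerD//; exact: le.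
Qed.

Lemma plucker_standard_fan K M N : convex_body2 K -> convex_body2 M -> convex_body2 N ->
  fan_size (contact K) e1 e2 (- (e1 + e2)) * mixed_area M N <=
  fan_size (contact N) e1 e2 (- (e1 + e2)) * mixed_area K M +
  fan_size (contact M) e1 e2 (- (e1 + e2)) * mixed_area K N.
Proof.
move=> bK bM bN; set z := - (e1 + e2).
have [tK [tM tN]] := (contact_tight bK, (contact_tight bM, contact_tight bN)).
have [sM sN] := (supp_sublinear tM, supp_sublinear tN).
set p := contact K in tK *; set q := contact M in tM sM *; set r := contact N in tN sN *.
have [||||F [G [H [hF hG hH FGH]]]] := @sup_add3_le
  (fun n => gapsum n.+1 (supp q) (supp r) e1 e2) (fun n => gapsum n.+1 (supp q) (supp r) e2 z)
  (fun n => gapsum n.+1 (supp q) (supp r) z e1)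
  (fan_size q e1 e2 z * fan_size r e1 e2 z - 2 * mixed_area M N).
- by move=> m n mn; exact: gapsum_le.
- by move=> m n mn; exact: gapsum_le.
- by move=> m n mn; exact: gapsum_le.
- move=> n; have := mixed_area_le_approx n.+1 bM bN.
  have [+ _] := mixed_approx_fan n tM tN.
  rewrite /fan_approx -/q -/r -/z; lra.
have up u v (S : R) : (forall n, gapsum n.+1 (supp q) (supp r) u v <= S) ->
    forall n, gapsum n (supp q) (supp r) u v <= S.
  by move=> HS n; apply: le_trans (HS n); exact: gapsum_leS.
have z0 : e1 + e2 + z = 0 by rewrite subrr.
have := fan_plucker tK tM tN z0 (up _ _ _ hF) (up _ _ _ hG) (up _ _ _ hH).
have size_ge0 s : tight s -> 0 <= fan_size s e1 e2 z.
  by move=> ts; apply: supp_triangle_ge0.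
(* Shrinking [K] to its touching points can only lower its mixed area with [L]. *)
have low L s : convex_body2 L -> s = contact L ->
    fan_size p e1 e2 z * fan_size s e1 e2 z -
    (fan_depth p s e1 e2 + fan_depth p s e2 z + fan_depth p s z e1) <= 2 * mixed_area K L.
  move=> bL ->; have tL := contact_tight bL.
  apply: mixed_area_ge => // n; have [_] := mixed_approx_fan n tK tL.
  apply: le_trans; rewrite /fan_approx -/z lerD2l lerN2.
  by apply: lerD; first apply: lerD; exact: gapsum_le_gapw.
have lM := ler_wpM2l (size_ge0 r tN) (low M q bM erefl).
have lN := ler_wpM2l (size_ge0 q tM) (low N r bN erefl).
have lMN : fan_size p e1 e2 z * (2 * mixed_area M N) <=
    fan_size p e1 e2 z * (fan_size q e1 e2 z * fan_size r e1 e2 z - (F + G + H)).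
  by rewrite ler_wpM2l ?size_ge0//; lra.
move: lM lN lMN => lM lN lMN main.
rewrite -(@ler_pM2l _ 2)//.
have := le_trans lMN (le_trans main (lerD lM lN)).
by congr (_ <= _); ring.
Qed.

Definition triangle_width K u v := hK K u + hK K v + hK K (- (u + v)).

Lemma triangle_width_linear_image u v K : convex_body2 K ->
  fan_size (contact (linear_image u v K)) e1 e2 (- (e1 + e2)) = triangle_width K u v.
Proof.
move=> bK; rewrite /fan_size.
have -> : - (e1 + e2) = (- 1, - 1) :> R * R by rewrite /e1 /e2; congr (_, _) => /=; ring.
by rewrite !supp_linear_image// !scale1r !scale0r addr0 add0r !scaleN1r -opprD.
Qed.

Lemma triangle_widthC K u v : triangle_width K u v = triangle_width K v u.
Proof. by rewrite /triangle_width [u + v]addrC [hK K u + _]addrC. Qed.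

Lemma triangle_widthZ K u v (t : R) : convex_body2 K -> 0 <= t ->
  triangle_width K (t *: u) (t *: v) = t * triangle_width K u v.
Proof.
move=> bK t0; have [_ hh] := supp_sublinear (contact_tight bK).
by rewrite /triangle_width -scalerDr -scalerN !hh// !mulrDr.
Qed.

Lemma triangle_widthD K u v u' v' : convex_body2 K ->
  triangle_width K (u + u') (v + v') <= triangle_width K u v + triangle_width K u' v'.
Proof.
move=> bK; have [sh _] := supp_sublinear (contact_tight bK).
have := sh u u'; have := sh v v'; have := sh (- (u + v)) (- (u' + v')).
by rewrite -opprD addrACA /triangle_width; lra.
Qed.

(** A linear map settles determinant 1. Both sides are homogeneous in [(u, v)], so scaling settles
    positive determinants, and exchanging [u] and [v] the negative ones. *)
Lemma plucker_triangle K M N u v : convex_body2 K -> convex_body2 M -> convex_body2 N ->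
  triangle_width K u v * mixed_area M N <=
  triangle_width N u v * mixed_area K M + triangle_width M u v * mixed_area K N.
Proof.
move=> bK bM bN.
have unimodular a b : cross a b = 1 -> triangle_width K a b * mixed_area M N <=
    triangle_width N a b * mixed_area K M + triangle_width M a b * mixed_area K N.
  move=> ab; have := plucker_standard_fan (convex_body2_linear_image a b bK)
    (convex_body2_linear_image a b bM) (convex_body2_linear_image a b bN).
  by rewrite !triangle_width_linear_image// !mixed_area_linear_image.
have positive a b : 0 < cross a b -> triangle_width K a b * mixed_area M N <=
    triangle_width N a b * mixed_area K M + triangle_width M a b * mixed_area K N.
  move=> ab; pose t := (Num.sqrt (cross a b))^-1.
  have t0 : 0 < t by rewrite invr_gt0 sqrtr_gt0.
  have ct : cross (t *: a) (t *: b) = 1.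
    transitivity (t ^+ 2 * cross a b).
      by rewrite /cross /= /GRing.scale /=; ring.
    by rewrite exprVn sqr_sqrtr ?mulVf// ?gt_eqF// ltW.
  have := unimodular _ _ ct; rewrite !(triangle_widthZ, ltW t0)// -!mulrA -mulrDr.
  by rewrite ler_pM2l.
have [uv|uv|uv0] := ltgtP (cross u v) 0; last 1 first.
- (* The normals are parallel: perturb them in a direction that makes the
     cross product positive. *)
  pose c := cross u e2 + cross e1 v.
  have [s [s1 sc]] : exists s : R, s ^+ 2 = 1 /\ 0 <= s * c.
    have [c0|c0] := leP 0 c; first by exists 1; rewrite expr1n mul1r.
    by exists (- 1); rewrite sqrrN expr1n mulN1r oppr_ge0 ltW.
  pose C := (triangle_width K (- (s *: e1)) (- (s *: e2)) * mixed_area M N +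
    triangle_width N (s *: e1) (s *: e2) * mixed_area K M +
    triangle_width M (s *: e1) (s *: e2) * mixed_area K N).
  apply: (@ler_addinvn _ _ _ C) => n; set e := n.+1%:R^-1.
  have e0 : 0 < e by rewrite invr_gt0 ltr0n.
  pose u' := u + e *: (s *: e1); pose v' := v + e *: (s *: e2).
  have := positive u' v'.
  have -> : cross u' v' = e * (s * c) + e ^+ 2 * s ^+ 2 + cross u v.
    by rewrite /c /u' /v' /cross /= /GRing.scale /=; ring.
  rewrite uv0 s1 addr0 mulr1 => /(_ _)-H.
  have {H} := H (ltr_wpDl (mulr_ge0 (ltW e0) sc) (exprn_gt0 2 e0)).
  have HK : triangle_width K u v <=
      triangle_width K u' v' + e * triangle_width K (- (s *: e1)) (- (s *: e2)).
    rewrite -(triangle_widthZ _ _ bK (ltW e0)).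
    have -> : triangle_width K u v = triangle_width K
        (u' + e *: - (s *: e1)) (v' + e *: - (s *: e2)).
      by rewrite /u' /v' !scalerN !addrK.
    exact: triangle_widthD.
  have up L : convex_body2 L -> triangle_width L u' v' <=
      triangle_width L u v + e * triangle_width L (s *: e1) (s *: e2).
    by move=> bL; rewrite -(triangle_widthZ _ _ bL (ltW e0)); exact: triangle_widthD.
  have := ler_wpM2r (mixed_area_ge0 bM bN) HK.
  have := ler_wpM2r (mixed_area_ge0 bK bM) (up N bN).
  have := ler_wpM2r (mixed_area_ge0 bK bN) (up M bM).
  rewrite /C -/e; clearbody e u' v'; lra.
- rewrite ![triangle_width _ u v]triangle_widthC; apply: positive.
  by rewrite -oppr_lt0 -[X in X < 0]opprK; move: uv; rewrite /cross; lra.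
- exact: positive.
Qed.

Theorem plucker_mixed_area K L M N :
  convex_body2 K -> convex_body2 L -> convex_body2 M -> convex_body2 N ->
  mixed_area K L * mixed_area M N <=
  mixed_area K M * mixed_area L N + mixed_area K N * mixed_area L M.
Proof.
move=> bK bL bM bN.
pose a := mixed_area K M; pose b := mixed_area K N; pose c := mixed_area M N.
(* The claim says that the mixed area of [L] with [g] is nonnegative; that [g] is nonnegative on
   triangles of normals is [plucker_triangle]. *)
pose g w := (a * hK N w + b * hK M w) + (- c) * hK K w.
have hg (t : R) w : 0 <= t -> g (t *: w) = t * g w.
  move=> t0; have hh L' : convex_body2 L' -> hK L' (t *: w) = t * hK L' w.
    by move=> bL'; have [_] := supp_sublinear (contact_tight bL'); apply.
  by rewrite /g !hh//; ring.
have tg : triangle_ge0 g.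
  move=> u v w uvw; have -> : w = - (u + v).
    by apply/eqP; rewrite -addr_eq0 addrC uvw.
  have := plucker_triangle u v bK bM bN.
  by rewrite /triangle_width /g -/a -/b -/c; lra.
have g0 n : 0 <= a * mixed_approx n (contact L) (hK N) +
    b * mixed_approx n (contact L) (hK M) + (- c) * mixed_approx n (contact L) (hK K).
  rewrite -!mixed_approxZ -!mixed_approxD.
  exact: (mixed_approx_ge0 n (contact_tight bL) hg tg).
have cv : (fun n => a * mixed_approx n (contact L) (hK N) +
    b * mixed_approx n (contact L) (hK M) + (- c) * mixed_approx n (contact L) (hK K)) @ \oo
  --> a * (2 * mixed_area L N) + b * (2 * mixed_area L M) + (- c) * (2 * mixed_area L K).
  by apply: cvgD; first apply: cvgD; apply: cvgM; first [exact: cvg_cst|exact: cvg_mixed_area].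
have : 0 <= a * (2 * mixed_area L N) + b * (2 * mixed_area L M) + (- c) * (2 * mixed_area L K).
  rewrite -(cvg_lim _ cv)//; apply: limr_ge; last by near=> n; exact: g0.
  by apply/cvg_ex; eexists; exact: cv.
rewrite [mixed_area L K]mixed_areaC -/a -/b -/c; lra.
Unshelve. all: by end_near.
Qed.

Lemma mixed_area_sumr K L M : convex_body2 K -> convex_body2 L -> convex_body2 M ->
  mixed_area K (minkowski_sum L M) = mixed_area K L + mixed_area K M.
Proof.
move=> bK bL bM; apply: (@mulfI _ 2) => //.
have cv := cvg_mixed_area bK (convex_body2_sum bL bM).
have cv' : (fun n => mixed_approx n (contact K) (hK L) +
    mixed_approx n (contact K) (hK M)) @ \oo --> 2 * mixed_area K L + 2 * mixed_area K M.
  by apply: cvgD; exact: cvg_mixed_area.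
rewrite mulrDr -(cvg_lim _ cv)// -(cvg_lim _ cv')//; congr (lim (_ @ \oo)).
apply: funext => n; rewrite -mixed_approxD; apply: eq_mixed_approx => // w.
exact: supp_sum.
Qed.

(** * Segments and their mixed areas *)

Definition segment u : set (R * R) := [set (t * u.1, t * u.2) | t in `[0, 1]].

Lemma convex_body2_segment u : convex_body2 (segment u).
Proof.
split; [|split].
- by exists (0 * u.1, 0 * u.2), 0 => //=; rewrite in_itv /= lexx ler01.
- apply: continuous_compact; last exact: segment_compact.
  apply: continuous_subspaceT => t.
  apply: (@cvg_pair _ _ _ (nbhs t) (nbhs (t * u.1)) (nbhs (t * u.2))).
  + by apply: cvgM; [exact: cvg_id|exact: cvg_cst].
  + by apply: cvgM; [exact: cvg_id|exact: cvg_cst].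
- move=> _ _ [a + <-] [b + <-] t t0 t1; rewrite /= !in_itv /= => /andP[a0 a1] /andP[b0 b1].
  exists (t * a + (1 - t) * b); last by congr (_, _) => /=; ring.
  rewrite /= in_itv /=; apply/andP; split.
    by rewrite addr_ge0 ?mulr_ge0// subr_ge0.
  have : t * a <= t * 1 by rewrite ler_wpM2l.
  have : (1 - t) * b <= (1 - t) * 1 by rewrite ler_wpM2l// subr_ge0.
  by lra.
Qed.

Lemma area_line w K : w != 0 -> convex_body2 K -> (forall z, K z -> dot z w = 0) ->
  area K = 0.
Proof.
move=> w0 bK Kw.
have n0 : 0 < w.1 ^+ 2 + w.2 ^+ 2.
  rewrite lt_neqAle addr_ge0 ?sqr_ge0// andbT eq_sym paddr_eq0 ?sqr_ge0// !sqrf_eq0.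
  by apply: contra w0 => /andP[/eqP w1 /eqP w2]; rewrite [w]surjective_pairing w1 w2.
(* Completes [w] to a unimodular map, which sends [K] into the null line where the first coordinate
   is 0. *)
pose w' := (- w.2 / (w.1 ^+ 2 + w.2 ^+ 2), w.1 / (w.1 ^+ 2 + w.2 ^+ 2)).
have ww' : cross w w' = 1.
  rewrite /cross /w' /=; field.
  by rewrite gt_eqF.
rewrite -(area_linear_image ww' bK) /area.
suff -> : mu (linear_image w w' K) = 0%E by [].
have null : mu ([set 0] `*` setT) = 0%E.
  by rewrite product_measure1E//= lebesgue_measure_set1 mul0e.
apply: (subset_measure0 _ _ _ null).
- apply: measurable_convex_body; exact: convex_body2_linear_image.
- by apply: measurableX => //; exact: measurable_set1.
- by move=> _ [z Kz <-]; split => //=; exact: Kw.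
Qed.

Lemma segment_line u w z : dot u w = 0 -> segment u z -> dot z w = 0.
Proof.
by move=> uw [t _ <-]; rewrite -[RHS](mulr0 t) -uw /dot /=; ring.
Qed.

Lemma mixed_area_segment u v : mixed_area (segment u) (segment v) = `|cross u v| / 2.
Proof.
wlog uv : u v / 0 <= cross u v.
  move=> H; have [|/ltW uv] := leP 0 (cross u v); first exact: H.
  have vu : cross v u = - cross u v by rewrite /cross; ring.
  by rewrite mixed_areaC H vu ?oppr_ge0// normrN.
have [bu bv] := (convex_body2_segment u, convex_body2_segment v).
have buv := convex_body2_sum bu bv.
rewrite ger0_norm// /mixed_area; congr (_ / 2).
have ne (a b : R) : (a, b) != 0 -> (- b, a) != 0 :> R * R.
  by rewrite -!pair_eqE /pair_eq /= oppr_eq0 andbC.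
move: uv; rewrite le_eqVlt => /predU1P[uv|uv].
  have [w [w0 uw vw]] : exists w, [/\ w != 0, dot u w = 0 & dot v w = 0].
    have [->|u0] := eqVneq u 0.
      have [->|v0] := eqVneq v 0.
        exists e1; split; rewrite ?/dot /= ?mul0r ?addr0//.
        by rewrite -pair_eqE /pair_eq /= oner_eq0.
      exists (- v.2, v.1); split; first by apply: ne; rewrite -surjective_pairing.
        by rewrite /dot /= !mul0r addr0.
      by rewrite /dot /=; ring.
    exists (- u.2, u.1); split; first by apply: ne; rewrite -surjective_pairing.
      by rewrite /dot /=; ring.
    by rewrite uv /dot /cross /=; ring.
  rewrite (area_line w0 bu) => [|z]; last exact: segment_line.
  rewrite (area_line w0 bv) => [|z]; last exact: segment_line.
  rewrite (area_line w0 buv) => [|_ [a [b [ua [vb ->]]]]]; first by rewrite !subr0.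
  have := segment_line uw ua; have := segment_line vw vb.
  by rewrite /dot /=; lra.
have null s : s != 0 -> area (segment s) = 0.
  rewrite {1}[s]surjective_pairing => /ne w0.
  apply: (area_line w0 (convex_body2_segment s)) => z; apply: segment_line.
  by rewrite /dot /=; ring.
have u0 : u != 0.
  by apply/eqP => u0; move: uv; rewrite u0 /cross /= !mul0r subrr ltxx.
have v0 : v != 0.
  by apply/eqP => v0; move: uv; rewrite v0 /cross /= !mulr0 subrr ltxx.
rewrite !null// !subr0.
have [c cE] : exists c, c = cross u v by exists (cross u v).
(* The dual basis, scaled to determinant 1: it maps the parallelogram spanned by [u] and [v] to a
   rectangle with sides 1 and [c]. *)
rewrite -cE in uv *; pose a := (v.2 / c, - v.1 / c); pose b := (- u.2, u.1).
have c0 : c != 0 by rewrite gt_eqF.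
have ab : cross a b = 1.
  by rewrite -(divff c0) {1}cE /a /b /cross /=; field.
have ua : dot u a = 1 by rewrite -(divff c0) {1}cE /dot /a /cross /=; field.
have va : dot v a = 0 by rewrite /dot /a /=; field.
have ub : dot u b = 0 by rewrite /dot /b /=; ring.
have vb : dot v b = c by rewrite cE /dot /b /cross /=; ring.
rewrite -(area_linear_image ab buv) /area.
have -> : linear_image a b (minkowski_sum (segment u) (segment v)) =
    (`[0, 1]%classic `*` `[0, c]%classic).
  have E (s t : R) x : dot (s * u.1 + t * v.1, s * u.2 + t * v.2) x = s * dot u x + t * dot v x.
    by rewrite /dot /=; ring.
  apply/seteqP; split.
    move=> _ [_ [_ [_ [[s + <-] [[t + <-] ->]]]] <-].
    rewrite [dot _ a]E [dot _ b]E ua va ub vb !(mulr0, mulr1) addr0 add0r.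
    rewrite /setX /= !in_itv /= => s01 /andP[t0 t1]; split => //.
    by rewrite mulr_ge0 ?ler_piMl// ltW.
  move=> [s t] [/= + +]; rewrite !in_itv /= => s01 /andP[t0 t1].
  exists (s * u.1 + t / c * v.1, s * u.2 + t / c * v.2).
    exists (s * u.1, s * u.2), (t / c * v.1, t / c * v.2); split.
      by exists s => //=; rewrite in_itv.
    split => //; exists (t / c) => //=; rewrite in_itv /=.
    by rewrite divr_ge0 ?ler_pdivrMr// ?mul1r// ltW.
  by rewrite !E ua va ub vb !(mulr0, mulr1) addr0 add0r divfK.
rewrite product_measure1E//= !lebesgue_measure_itv /= !lte_fin ltr01 uv.
by rewrite !oppr0 !adde0 mul1e.
Qed.

End ConvexBodies.

(** * Realization *)

Section Realization.
Context {R : realType}.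

Definition realizable (v12 v13 v14 v23 v24 v34 : R) := exists K1 K2 K3 K4 : set (R * R),
  [/\ convex_body2 K1, convex_body2 K2, convex_body2 K3 & convex_body2 K4] /\
  (v12 = mixed_area K1 K2 /\ v13 = mixed_area K1 K3 /\ v14 = mixed_area K1 K4 /\
   v23 = mixed_area K2 K3 /\ v24 = mixed_area K2 K4 /\ v34 = mixed_area K3 K4).

(** Adjacent transpositions generate all relabellings, so each type of configuration is realized in
    one labelling only. *)
Lemma realizable_swap12 (v12 v13 v14 v23 v24 v34 : R) :
  realizable v12 v23 v24 v13 v14 v34 -> realizable v12 v13 v14 v23 v24 v34.
Proof.
move=> [K1 [K2 [K3 [K4 [[b1 b2 b3 b4] [-> [-> [-> [-> [-> ->]]]]]]]]]].
by exists K2, K1, K3, K4; split => //; rewrite [mixed_area K2 K1]mixed_areaC.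
Qed.

Lemma realizable_swap23 (v12 v13 v14 v23 v24 v34 : R) :
  realizable v13 v12 v14 v23 v34 v24 -> realizable v12 v13 v14 v23 v24 v34.
Proof.
move=> [K1 [K2 [K3 [K4 [[b1 b2 b3 b4] [-> [-> [-> [-> [-> ->]]]]]]]]]].
by exists K1, K3, K2, K4; split => //; rewrite [mixed_area K3 K2]mixed_areaC.
Qed.

Lemma realizable_swap34 (v12 v13 v14 v23 v24 v34 : R) :
  realizable v12 v14 v13 v24 v23 v34 -> realizable v12 v13 v14 v23 v24 v34.
Proof.
move=> [K1 [K2 [K3 [K4 [[b1 b2 b3 b4] [-> [-> [-> [-> [-> ->]]]]]]]]]].
by exists K1, K2, K4, K3; split => //; rewrite [mixed_area K4 K3]mixed_areaC.
Qed.

Lemma realizable_segments (u1 u2 u3 u4 : R * R) : realizable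
  (`|cross u1 u2| / 2) (`|cross u1 u3| / 2) (`|cross u1 u4| / 2)
  (`|cross u2 u3| / 2) (`|cross u2 u4| / 2) (`|cross u3 u4| / 2).
Proof.
exists (segment u1), (segment u2), (segment u3), (segment u4).
split; first by split; exact: convex_body2_segment.
by rewrite !mixed_area_segment.
Qed.

Lemma realizable_star (v12 v13 v14 : R) : 0 <= v12 -> 0 <= v13 -> 0 <= v14 ->
  realizable v12 v13 v14 0 0 0.
Proof.
move=> h2 h3 h4.
have := realizable_segments (1, 0) (0, 2 * v12) (0, 2 * v13) (0, 2 * v14).
rewrite /cross /= !(mul1r, mul0r, mulr0, subr0) !normr0 !mul0r.
by rewrite !ger0_norm ?mulr_ge0// ![2 * _]mulrC !mulfK.
Qed.

(** For [v14 = v23 = 0] the inequalities force this equation; it is realized by two pairs of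
    parallel segments, 1 with 4 and 2 with 3. *)
Lemma realizable_cycle (v12 v13 v24 v34 : R) : 0 < v12 -> 0 <= v13 -> 0 <= v24 ->
  v12 * v34 = v13 * v24 -> realizable v12 v13 0 0 v24 v34.
Proof.
move=> h2 h3 h4 E.
have := realizable_segments (1, 0) (0, 2 * v12) (0, 2 * v13) (v24 / v12, 0).
have n0 : v12 != 0 by rewrite gt_eqF.
have h34 : v34 = v13 * v24 / v12 by rewrite -E; field.
rewrite /cross /= !(mul1r, mul0r, mulr0, subr0, sub0r, normrN) !normr0 !mul0r h34.
have z12 := ltW h2; rewrite !ger0_norm ?mulr_ge0 ?invr_ge0//.
have -> : 2 * v12 / 2 = v12 by field.
have -> : 2 * v13 / 2 = v13 by field.
have -> : 2 * v12 * (v24 / v12) / 2 = v24 by field.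
by have -> : 2 * v13 * (v24 / v12) / 2 = v13 * v24 / v12 by field.
Qed.

(* The fourth body is a hexagon whose sides are parallel to the three segments;
   their lengths are the coordinates of the triple of products in the basis of
   extreme rays of the cone of triangle inequalities. *)
Lemma realizable_hexagon (v12 v13 v14 v23 v24 v34 : R) : 0 < v12 -> 0 < v13 -> 0 < v23 ->
  v12 * v34 <= v13 * v24 + v14 * v23 -> v13 * v24 <= v12 * v34 + v14 * v23 ->
  v14 * v23 <= v12 * v34 + v13 * v24 -> realizable v12 v13 v14 v23 v24 v34.
Proof.
move=> h12 h13 h23 A B C.
have [n12 n13 n23] : [/\ v12 != 0, v13 != 0 & v23 != 0] by rewrite !gt_eqF.
pose a := (v12 * v34 + v13 * v24 - v14 * v23) / (2 * v12 * v13).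
pose b := (v12 * v34 + v14 * v23 - v13 * v24) / (2 * v12 * v23).
pose c := (v13 * v24 + v14 * v23 - v12 * v34) / (2 * v13 * v23).
have [[z12 z13] z23] := (ltW h12, ltW h13, ltW h23).
have a0 : 0 <= a by rewrite divr_ge0 ?mulr_ge0//; lra.
have b0 : 0 <= b by rewrite divr_ge0 ?mulr_ge0//; lra.
have c0 : 0 <= c by rewrite divr_ge0 ?mulr_ge0//; lra.
have E14 : v14 = b * v12 + c * v13 by rewrite /b /c; field; rewrite n12 n13 n23.
have E24 : v24 = a * v12 + c * v23 by rewrite /a /c; field; rewrite n12 n13 n23.
have E34 : v34 = a * v13 + b * v23 by rewrite /a /b; field; rewrite n12 n13 n23.
clearbody a b c.
pose u1 : R * R := (1, 0); pose u2 : R * R := (0, 2 * v12).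
pose u3 : R * R := (v23 / v12, 2 * v13).
have bs u := @convex_body2_segment R u.
have [x12 x13 x23] : [/\ cross u1 u2 = 2 * v12, cross u1 u3 = 2 * v13 &
    cross u2 u3 = - (2 * v23)].
  by rewrite /cross /=; split; field.
have seg (x y : R * R) (t d : R) : 0 <= t -> 0 <= d -> `|cross x y| = 2 * d ->
    mixed_area (segment x) (segment (t *: y)) = t * d.
  move=> t0 d0 xy; rewrite mixed_area_segment.
  have -> : cross x (t *: y) = t * cross x y.
    by rewrite /cross /= /GRing.scale /=; ring.
  by rewrite normrM xy ger0_norm//; field.
have crossC (x y : R * R) : `|cross x y| = `|cross y x|.
  by rewrite -normrN; congr (`|_|); rewrite /cross; ring.
have [y12 y13 y23] : [/\ `|cross u1 u2| = 2 * v12, `|cross u1 u3| = 2 * v13 &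
    `|cross u2 u3| = 2 * v23].
  by rewrite x12 x13 x23 normrN !ger0_norm// mulr_ge0// ltW.
(* A hexagon side parallel to the segment contributes nothing; the form [2 * 0] fits [seg]. *)
have self (x : R * R) : `|cross x x| = 2 * 0.
  by rewrite /cross mulrC subrr normr0 mulr0.
exists (segment u1), (segment u2), (segment u3).
exists (minkowski_sum (segment (a *: u1))
  (minkowski_sum (segment (b *: u2)) (segment (c *: u3)))).
split; first by split => //; do 2?apply: convex_body2_sum => //.
rewrite !mixed_area_sumr//; try exact: convex_body2_sum.
rewrite (mixed_area_segment u1 u2) (mixed_area_segment u1 u3) (mixed_area_segment u2 u3).
rewrite y12 y13 y23.
rewrite !(seg _ _ _ _ a0 (lexx 0) (self _)) !(seg _ _ _ _ b0 (lexx 0) (self _))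
  !(seg _ _ _ _ c0 (lexx 0) (self _)).
have w12 := y12; have w13 := y13; have w23 := y23.
rewrite crossC in w12; rewrite crossC in w13; rewrite crossC in w23.
rewrite (seg _ _ _ _ b0 z12 y12) (seg _ _ _ _ c0 z13 y13).
rewrite (seg _ _ _ _ a0 z12 w12) (seg _ _ _ _ c0 z23 y23).
rewrite (seg _ _ _ _ a0 z13 w13) (seg _ _ _ _ b0 z23 w23).
by rewrite E14 E24 E34; do !split; field.
Qed.

(** If the coordinates within 123 or within 124 are all positive, the hexagon applies. Otherwise
    each of 3 and 4 has a zero coordinate with 1 or 2: both zeros at the same body force [v34 = 0]
    and give a star, zeros at different bodies give a cycle. *)
Lemma realizable_edge12 (v12 v13 v14 v23 v24 v34 : R) : 0 < v12 -> 0 <= v13 -> 0 <= v14 ->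
  0 <= v23 -> 0 <= v24 -> 0 <= v34 ->
  v12 * v34 <= v13 * v24 + v14 * v23 -> v13 * v24 <= v12 * v34 + v14 * v23 ->
  v14 * v23 <= v12 * v34 + v13 * v24 -> realizable v12 v13 v14 v23 v24 v34.
Proof.
move=> h12 h13 h14 h23 h24 h34 A B C.
have h34_0 : v12 * v34 <= 0 -> v34 = 0.
  by rewrite pmulr_rle0// => H; apply/eqP; rewrite eq_le H.
have pos (x : R) : 0 <= x -> x = 0 \/ 0 < x.
  by rewrite le_eqVlt => /predU1P[<-|]; [left|right].
have [e13|p13] := pos _ h13.
  rewrite e13 !mul0r ?add0r ?addr0 in A B C *.
  have [e14|p14] := pos _ h14.
    rewrite e14 !mul0r in A *; rewrite (h34_0 A).
    by apply: realizable_swap12; exact: realizable_star (ltW h12) h23 h24.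
  have [e24|p24] := pos _ h24.
    apply: realizable_swap34; rewrite e24; apply: realizable_cycle => //; lra.
  by apply: realizable_swap34; apply: realizable_hexagon => //; lra.
have [e23|p23] := pos _ h23; last exact: realizable_hexagon.
rewrite e23 !mulr0 ?add0r ?addr0 in A B C *.
have [e14|p14] := pos _ h14.
  by rewrite e14; apply: realizable_cycle => //; lra.
have [e24|p24] := pos _ h24.
  rewrite e24 !mulr0 in A *; rewrite (h34_0 A).
  exact: realizable_star (ltW h12) h13 h14.
by apply: realizable_swap34; apply: realizable_hexagon => //; lra.
Qed.

Lemma realizable_ptolemy (v12 v13 v14 v23 v24 v34 : R) :
  0 <= v12 -> 0 <= v13 -> 0 <= v14 -> 0 <= v23 -> 0 <= v24 -> 0 <= v34 ->
  v12 * v34 <= v13 * v24 + v14 * v23 -> v13 * v24 <= v12 * v34 + v14 * v23 ->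
  v14 * v23 <= v12 * v34 + v13 * v24 -> realizable v12 v13 v14 v23 v24 v34.
Proof.
move=> h12 h13 h14 h23 h24 h34 A B C.
have pos (x : R) : 0 <= x -> x = 0 \/ 0 < x.
  by rewrite le_eqVlt => /predU1P[<-|]; [left|right].
have [e12|p12] := pos _ h12; last exact: realizable_edge12.
have [e13|p13] := pos _ h13; last first.
  by apply: realizable_swap23; apply: realizable_edge12 => //; lra.
have [e14|p14] := pos _ h14; last first.
  by apply: realizable_swap34; apply: realizable_swap23; apply: realizable_edge12 => //; lra.
have [e23|p23] := pos _ h23; last first.
  by apply: realizable_swap12; apply: realizable_swap23; apply: realizable_edge12 => //; lra.
have [e24|p24] := pos _ h24; last first.
  apply: realizable_swap12; apply: realizable_swap34; apply: realizable_swap23.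
  by apply: realizable_edge12 => //; lra.
(* Only [v34] may be nonzero: a star centred at the third body. *)
rewrite e12 e13 e14 e23 e24.
by apply: realizable_swap23; apply: realizable_swap12; exact: realizable_star.
Qed.

End Realization.

Unset Implicit Arguments.

(* (v12, v13, v14, v23, v24, v34) lies in PMV(4,2) iff it is nonnegative and
   satisfies the three "Ptolemy"-type inequalities, one per partition
   {i,j} ⊔ {k,l} = {1,2,3,4}. *)
Theorem mainTheorem3 (R : realType) (v12 v13 v14 v23 v24 v34 : R) :
  (exists K1 K2 K3 K4 : set (R * R),
     [/\ convex_body2 K1, convex_body2 K2, convex_body2 K3 & convex_body2 K4] /\
     (v12 = mixed_area K1 K2 /\ v13 = mixed_area K1 K3 /\ v14 = mixed_area K1 K4 /\
      v23 = mixed_area K2 K3 /\ v24 = mixed_area K2 K4 /\ v34 = mixed_area K3 K4))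
  <->
  ((0 <= v12 /\ 0 <= v13 /\ 0 <= v14 /\ 0 <= v23 /\ 0 <= v24 /\ 0 <= v34) /\
   [/\ v12 * v34 <= v13 * v24 + v14 * v23,
       v13 * v24 <= v12 * v34 + v14 * v23 &
       v14 * v23 <= v12 * v34 + v13 * v24]).
Proof.
split; last first.
  by move=> [[h12 [h13 [h14 [h23 [h24 h34]]]]] [A B C]]; exact: realizable_ptolemy.
move=> [K1 [K2 [K3 [K4 [[b1 b2 b3 b4] [-> [-> [-> [-> [-> ->]]]]]]]]]].
split; first by do !split; exact: mixed_area_ge0.
split.
- exact: plucker_mixed_area.
- by have := plucker_mixed_area b1 b3 b2 b4; rewrite [mixed_area K3 K2]mixed_areaC.
- have := plucker_mixed_area b1 b4 b2 b3.
  by rewrite [mixed_area K4 K3]mixed_areaC [mixed_area K4 K2]mixed_areaC.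
Qed.
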